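(* Let $d\ge 3$, $\sigma^2>0$ known, and $Z\sim N_d(\theta,\sigma^2 I_d)$ with $\theta\in\mathbb{R}^d$ unknown. Let $p>0$, $0\le\alpha<(d-2)/(d-1)$, and $$0<c\le 2(d-2)\gamma(d,p,\alpha),\qquad \gamma(d,p,\alpha)=\min\bigl(1,d^{(2-p-\alpha)/p}\bigr)\left\{1-\alpha\frac{d-1}{d-2}\right\}.$$ Then the estimator $\hat\theta^+$ of $\theta$ whose $i$-th component ($i=1,\dots,d$) is $$\hat\theta^+_i(z)=\max\left(0,\,1-\frac{c\,\sigma^2}{\|z\|_p^{2-\alpha}|z_i|^{\alpha}}\right)z_i$$ is minimax.
   Context: For $p>0$, $\|z\|_p=\{\sum_{i=1}^d|z_i|^p\}^{1/p}$. The loss of an estimator $\delta$ is $L(\delta,\theta)=\sum_{i=1}^d(\delta_i-\theta_i)^2/\sigma^2$ and its risk is $E[L(\delta(Z),\theta)]$. An estimator is minimax if it minimizes $\sup_\theta E[L(\delta(Z),\theta)]$ among all estimators. The estimator $z$ is minimax with constant risk $d$, so $\delta$ is minimax if and only if its risk is at most $d$ for every $\theta$. The estimator is defined for $z$ with all coordinates nonzero, which holds almost surely. *)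

(* Defs.v *)
From mathcomp Require Import all_boot all_order all_algebra.
From mathcomp Require Import all_classical all_reals all_analysis.

Set Implicit Arguments.
Unset Strict Implicit.
Unset Printing Implicit Defensive.

Import Order.TTheory GRing.Theory Num.Theory.

Local Open Scope classical_set_scope.
Local Open Scope ring_scope.

(* Vectors of R^d are d-tuples, the type on which the library puts the product
   Borel sigma-algebra. *)

(* Not a norm when p < 1: the triangle inequality fails. *)
Definition lpnorm (R : realType) (d : nat) (p : R) (z : d.-tuple R) : R :=
  (\sum_(i < d) `|tnth z i| `^ p) `^ p^-1.

(* Z ~ N_d(theta, sigma^2 I_d) under P: the law of Z is the product of the
   one-dimensional laws N(theta_i, sigma^2), which is characterized by its
   values on measurable boxes. As in normal_prob, sigma is the standard
   deviation. *)
Definition normal_vector (R : realType) (d : nat) (disp : measure_display)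
    (T : measurableType disp) (P : probability T R)
    (Z : {mfun T >-> d.-tuple R}) (theta : d.-tuple R) (sigma : R) : Prop :=
  forall B : 'I_d -> set R, (forall i, measurable (B i)) ->
    P [set w | forall i, B i (tnth (Z w) i)] =
    (\prod_(i < d) normal_prob (tnth theta i) sigma (B i))%E.

Section decision_problem.
Context (R : realType) (d : nat) (disp : measure_display)
  (T : measurableType disp).
Variables (P : d.-tuple R -> probability T R) (Z : {mfun T >-> d.-tuple R}).
Variable sigma : R.

Definition loss (a theta : d.-tuple R) : R :=
  \sum_(i < d) (tnth a i - tnth theta i) ^+ 2 / sigma ^+ 2.

(* The loss is nonnegative, so this expectation always makes sense and may be
   +oo. *)
Definition risk (delta : d.-tuple R -> d.-tuple R) (theta : d.-tuple R)
    : \bar R :=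
  'E_(P theta)[fun w => loss (delta (Z w)) theta].

Definition estimator (delta : d.-tuple R -> d.-tuple R) : Prop :=
  measurable_fun [set: d.-tuple R] delta.

Definition max_risk (delta : d.-tuple R -> d.-tuple R) : \bar R :=
  ereal_sup (range (risk delta)).

Definition minimax (delta : d.-tuple R -> d.-tuple R) : Prop :=
  estimator delta /\
  forall delta', estimator delta' -> (max_risk delta <= max_risk delta')%E.

End decision_problem.

Definition gamma_const (R : realType) (d : nat) (p alpha : R) : R :=
  Num.min 1 (d%:R `^ ((2 - p - alpha) / p)) *
  (1 - alpha * ((d%:R - 1) / (d%:R - 2))).

(* A coordinate z_i = 0 is sent to 0, whatever value the total operations of
   the library give to the shrinkage factor. *)
Definition theta_plus (R : realType) (d : nat) (p alpha c sigma : R)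
    (z : d.-tuple R) : d.-tuple R :=
  [tuple Num.max 0
     (1 - c * sigma ^+ 2 /
          (lpnorm p z `^ (2 - alpha) * `|tnth z i| `^ alpha)) * tnth z i
   | i < d].

(* Main.v *)
Require Import Defs.
From mathcomp Require Import all_boot all_order all_algebra.
From mathcomp Require Import all_classical all_reals all_analysis.
From mathcomp Require Import measurable_realfun ring lra.

(** Minimaxity amounts to two bounds: the estimator has risk at most [d] for
    every mean (upper bound), and every estimator has maximal risk at least [d]
    (lower bound).

    Upper bound. The usual argument applies Stein's identity to the estimator
    without positive part, which is singular on the coordinate hyperplanes.
    Replacing each [|z_i|] by the square root of [z_i^2 + e] removes the
    singularity, and it costs nothing: the derivative of the square root only
    introduces factors [z_i^2 / (z_i^2 + e)] in [0, 1], all on the favourable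
    side ([dshrink1_ge]), so the regularized unbiased risk estimate is pointwise
    at most [d * s^2], where [s] is the standard deviation
    ([sum_unbiased_risk_le]). The inequality behind this,
    [shrinkage_inequality], is Chebyshev's sum inequality used twice together
    with a comparison of power sums. Three further steps are needed. Taking the
    positive part of a shrinkage factor that is even in [z_i] does not increase
    the risk, since the normal density is larger on the side of its mean
    ([positive_part_le]). One-dimensional integrals are transferred to the law
    of the vector by resampling a single coordinate ([resample]): the law is
    left unchanged, because it agrees with the original one on boxes, and
    hence no iterated integral over all coordinates is ever needed. Finally
    [e] tends to 0 by Fatou's lemma; pointwise convergence holds everywhere,
    also on the hyperplanes, where both estimators vanish in the coordinate
    concerned ([cvg_regularized]).

    Lower bound. The maximal risk is at least the Bayes risk for the prior
    [theta = k * A], where [A] is an independent copy of the observation at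
    mean 0. Resampling the coordinate [i] of both vectors reduces the
    [i]-th coordinate of the Bayes risk to a one-dimensional problem, whatever
    the values of the other coordinates ([bayes_risk_coordinate]). There,
    completing the square factors the joint density into marginal times
    posterior ([normal_posterior]), and the mean squared error is at least the
    posterior variance ([bayes_risk1]). The resulting bound
    [d * k^2 / (1 + k^2)] tends to [d] as [k] grows. *)

Import Order.TTheory GRing.Theory Num.Theory.
Import numFieldNormedType.Exports.
Local Open Scope classical_set_scope.
Local Open Scope ring_scope.

(** * Sum inequalities *)

Section inequalities.
Context {R : realType}.

(** Summing the hypothesis over all pairs of indices gives twice the difference
    of the two sides. *)
Lemma chebyshev_sum (d : nat) (u v : 'I_d -> R) :
  (forall i j, (u i - u j) * (v i - v j) <= 0) ->
  d%:R * (\sum_i u i * v i) <= (\sum_i u i) * (\sum_i v i).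
Proof.
move=> uv.
have e1 : \sum_(i < d) \sum_(j < d) (u i - u j) * (v i - v j) =
    (d%:R * (\sum_i u i * v i) - (\sum_i u i) * (\sum_i v i)) *+ 2.
  transitivity (\sum_(i < d) \sum_(j < d) (u i * v i - u j * v i)
              + \sum_(i < d) \sum_(j < d) (u j * v j - u i * v j)).
    rewrite -big_split; apply: eq_bigr => i _ /=.
    rewrite -big_split; apply: eq_bigr => j _ /=; ring.
  rewrite [X in _ + X]exchange_big/= mulr2n.
  have -> : \sum_(i < d) \sum_(j < d) (u i * v i - u j * v i) =
     d%:R * (\sum_i u i * v i) - (\sum_i u i) * (\sum_i v i) => //.
  rewrite mulr_sumr mulr_sumr -sumrB; apply: eq_bigr => i _.
  by rewrite sumrB sumr_const card_ord mulr_natl -mulr_suml.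
have : \sum_(i < d) \sum_(j < d) (u i - u j) * (v i - v j) <= 0.
  by apply: sumr_le0 => i _; apply: sumr_le0 => j _; exact: uv.
by rewrite e1 pmulrn_lle0// subr_le0.
Qed.

(** The concave function [y^r] lies below its tangent at 1; this is Young's
    inequality for the product [y^r * 1] with exponents [1/r] and [1/(1-r)]. *)
Lemma powR_le_tangent (y r : R) : 0 <= y -> 0 < r <= 1 ->
  y `^ r <= 1 + r * (y - 1).
Proof.
move=> y0 /andP[r0]; rewrite le_eqVlt => /predU1P[->|r1].
  by rewrite powRr1// mul1r addrCA subrr addr0.
have := @conjugate_powR R (y `^ r) 1 r^-1 (1 - r)^-1 (powR_ge0 _ _) ler01.
rewrite !invr_gt0 subr_gt0 !invrK => /(_ r0 r1).
rewrite addrC subrK => /(_ erefl).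
rewrite mulr1 -powRrM mulfV ?gt_eqF// powRr1// powR1 mul1r => h.
by apply: (le_trans h); lra.
Qed.

(** For [1 <= r] each normalized term [v_i / S] lies in [0, 1] and decreases
    under the power [r]; for [r < 1] the tangent inequality is applied to
    [d * v_i / S], whose mean is 1. *)
Lemma power_mean (d : nat) (r : R) (v : 'I_d -> R) : 0 < r ->
  (forall i, 0 <= v i) ->
  Num.min 1 (d%:R `^ (r - 1)) * (\sum_i v i `^ r) <= (\sum_i v i) `^ r.
Proof.
move=> r0 v0; set S := \sum_i v i.
have S0 : 0 <= S by apply: sumr_ge0.
have T0 : 0 <= \sum_i v i `^ r by apply: sumr_ge0 => i _; exact: powR_ge0.
have [S00|Sn0] := eqVneq S 0.
  have v00 i : v i = 0.
    by move: S00 => /eqP; rewrite psumr_eq0// => /allP/(_ i (mem_index_enum _))/eqP.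
  rewrite big1 ?mulr0 ?powR_ge0// => i _.
  by rewrite v00 powR0// gt_eqF.
have Sgt0 : 0 < S by rewrite lt_neqAle eq_sym Sn0.
have vS i : v i <= S by rewrite /S (bigD1 i)//= lerDl sumr_ge0.
have [r1|r1] := leP 1 r.
  apply: (@le_trans _ _ (\sum_i v i `^ r)).
    by rewrite ler_piMl// ge_min lexx.
  apply: (@le_trans _ _ (\sum_i (v i / S) * S `^ r)); last first.
    by rewrite -mulr_suml -mulr_suml -/S divff// mul1r.
  apply: ler_sum => i _.
  rewrite -{1}(divfK Sn0 (v i)) powRM ?divr_ge0//.
  rewrite ler_wpM2r ?powR_ge0//.
  have [->|vi0] := eqVneq (v i) 0; first by rewrite mul0r powR0// gt_eqF.
  apply: ge1r_powR => //.
  have vi1 : 0 < v i by rewrite lt_neqAle eq_sym vi0 v0.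
  by rewrite divr_gt0//= ler_pdivrMr// mul1r.
have d0 : (0 < d)%N.
  rewrite lt0n; apply/negP => /eqP d00; move: Sn0.
  by rewrite /S; subst d; rewrite big_ord0 eqxx.
have dR0 : 0 < d%:R :> R by rewrite ltr0n.
apply: (@le_trans _ _ (d%:R `^ (r - 1) * \sum_i v i `^ r)).
  by apply: ler_wpM2r => //; rewrite ge_min lexx orbT.
have key : \sum_i (d%:R * (v i / S)) `^ r <= d%:R.
  apply: (@le_trans _ _ (\sum_(i < d) (1 + r * (d%:R * (v i / S) - 1)))).
    apply: ler_sum => i _; apply: powR_le_tangent; last by rewrite r0 ltW.
    by apply: mulr_ge0; [exact: ltW|exact: divr_ge0].
  rewrite big_split/= -mulr_sumr big_split/= -mulr_sumr -mulr_suml -/S divff//.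
  by rewrite !sumr_const card_ord mulr1 mulNrn subrr mulr0 addr0.
have -> : d%:R `^ (r - 1) * \sum_i v i `^ r =
   d%:R^-1 * S `^ r * \sum_i (d%:R * (v i / S)) `^ r.
  rewrite powRB ?(gt_eqF dR0) ?implybT// (powRr1 (ltW dR0)) 2!mulr_sumr.
  apply: eq_bigr => i _.
  have viS : 0 <= v i / S by exact: divr_ge0.
  have -> : v i `^ r = (v i / S) `^ r * S `^ r by rewrite -powRM// divfK.
  by rewrite (powRM _ (ltW dR0) viS); ring.
rewrite mulrAC ler_piMl ?powR_ge0//.
by rewrite -ler_pdivlMl ?invr_gt0// invrK mulr1.
Qed.

Lemma powR_opposite_monotone (x y a b : R) : 0 < x -> 0 < y -> 0 <= a -> 0 <= b ->
  (x `^ (- a) - y `^ (- a)) * (x `^ b - y `^ b) <= 0.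
Proof.
wlog xy : x y / x <= y => [h x0 y0 a0 b0|x0 y0 a0 b0].
  have [|/ltW] := leP x y => xy; first exact: h.
  by rewrite -opprB -[_ `^ b - _]opprB mulrNN; exact: h.
have xyp r : 0 <= r -> x `^ r <= y `^ r.
  by move=> r0; apply: ge0_ler_powR; rewrite ?nnegrE// ltW.
apply: mulr_ge0_le0; rewrite ?subr_ge0 ?subr_le0 ?powRN; last exact: xyp.
by rewrite lef_pV2 ?posrE ?powR_gt0//; exact: xyp.
Qed.

(** With [t_i = z_i^2], this says that the unbiased risk estimate of the
    shrinkage estimator is at most that of the identity. Both sides are compared
    with the sum of the [t_i^(-a/2)]: the negative powers are oppositely ordered
    to the positive ones, so Chebyshev's inequality splits them off on the left
    and on the right, and [power_mean] with [r = (2 - a) / p] absorbs the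
    remaining power sum. This is where the two factors of [gamma_const] arise. *)
Lemma shrinkage_inequality (d : nat) (p a c S : R) (t : 'I_d -> R) : (3 <= d)%N ->
  0 < p -> 0 <= a -> a < (d%:R - 2) / (d%:R - 1) -> 0 < c ->
  c <= 2 * (d%:R - 2) * gamma_const d p a -> (forall i, 0 < t i) ->
  S = \sum_i t i `^ (p / 2) ->
  c * (S `^ ((a - 2) / p) * \sum_i t i `^ (1 - a)) <=
  2 * \sum_i t i `^ (- (a / 2)) * (1 - a - (2 - a) * (t i `^ (p / 2) / S)).
Proof.
move=> d3 p0 a0 a1 c0 cle t0 SE.
have d3R : 3 <= d%:R :> R by rewrite ler_nat.
have a1' : a < 1.
  apply: (lt_le_trans a1); rewrite ler_pdivrMr; lra.
have S0 : 0 < S.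
  rewrite SE; case: d d3 {a1 cle d3R SE} t t0 => // d _ t t0.
  rewrite big_ord_recl ltr_pwDl ?powR_gt0// sumr_ge0// => i _; exact: powR_ge0.
set A := \sum_i t i `^ (- (a / 2)).
have A0 : 0 <= A by apply: sumr_ge0 => i _; exact: powR_ge0.
set k := 1 - a * ((d%:R - 1) / (d%:R - 2)).
have k0 : 0 < k.
  rewrite /k subr_gt0 mulrA ltr_pdivrMr; last lra.
  by move: a1; rewrite ltr_pdivlMr; lra.
have kE : (d%:R - 2) * k = d%:R - 2 - a * (d%:R - 1).
  rewrite /k; field; lra.
pose r := (2 - a) / p.
have r0 : 0 < r by rewrite divr_gt0; lra.
set m := Num.min 1 (d%:R `^ (r - 1)).
have gE : gamma_const d p a = m * k.
  rewrite /gamma_const /m /k; congr (Num.min 1 (_ `^ _) * _).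
  rewrite /r; field; lra.
have m0 : 0 <= m by rewrite le_min ler01 powR_ge0.
pose T := \sum_i t i `^ (1 - a / 2).
have T0 : 0 <= T by apply: sumr_ge0 => i _; exact: powR_ge0.
have pm : m * T <= S `^ r.
  have := @power_mean d r (fun i => t i `^ (p / 2)) r0 (fun i => powR_ge0 _ _).
  rewrite -/m -SE; congr (m * _ <= _).
  apply: eq_bigr => i _; rewrite -powRrM; congr (_ `^ _); rewrite /r; field; lra.
have ch1 : d%:R * (\sum_i t i `^ (1 - a)) <= A * T.
  apply: le_trans (@chebyshev_sum d (fun i => t i `^ (- (a / 2)))
     (fun i => t i `^ (1 - a / 2)) _); last first.
    by move=> i j; apply: powR_opposite_monotone => //; lra.
  rewrite ler_wpM2l// ler_sum// => i _.
  rewrite -powRD; last by rewrite (gt_eqF (t0 i)) implybT.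
  by rewrite le_eqVlt; apply/orP; left; apply/eqP; congr (_ `^ _); lra.
have ch2 : d%:R * (\sum_i t i `^ (- (a / 2)) * t i `^ (p / 2)) <= A * S.
  by rewrite SE; apply: chebyshev_sum => i j; apply: powR_opposite_monotone => //; lra.
have -> : (a - 2) / p = - r by rewrite /r; field; lra.
rewrite powRN.
have rhsE : \sum_i t i `^ (- (a / 2)) * (1 - a - (2 - a) * (t i `^ (p / 2) / S)) =
    (1 - a) * A - (2 - a) / S * \sum_i t i `^ (- (a / 2)) * t i `^ (p / 2).
  rewrite !mulr_sumr -sumrB; apply: eq_bigr => i _; ring.
rewrite rhsE.
set U := \sum_i t i `^ (1 - a) in ch1 *.
set V := \sum_i _ in ch2 *.
have Sr0 : 0 < S `^ r by rewrite powR_gt0.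
have U0 : 0 <= U by apply: sumr_ge0 => i _; exact: powR_ge0.
have dR0 : 0 < d%:R :> R by lra.
have h2 : V / S <= A / d%:R.
  by rewrite ler_pdivrMr// mulrAC ler_pdivlMr// mulrC.
have h1 : c * ((S `^ r)^-1 * U) <= 2 * (((d%:R - 2) * k) * (A / d%:R)).
  rewrite (_ : c * _ = c * U / S `^ r); last ring.
  rewrite ler_pdivrMr//.
  apply: (@le_trans _ _ (2 * (d%:R - 2) * (m * k) * U)).
    by rewrite ler_wpM2r// -gE.
  apply: (@le_trans _ _ (2 * (d%:R - 2) * (m * k) * (A * T / d%:R))).
    apply: ler_wpM2l; last by rewrite ler_pdivlMr// mulrC.
    by rewrite mulr_ge0//; [lra|rewrite mulr_ge0// ltW].
  have -> : 2 * (d%:R - 2) * (m * k) * (A * T / d%:R) =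
    2 * ((d%:R - 2) * k * (A / d%:R)) * (m * T) by ring.
  apply: ler_wpM2l => //; apply: mulr_ge0 => //; apply: mulr_ge0.
    by rewrite kE -kE mulr_ge0 ?ltW//; lra.
  by rewrite divr_ge0// ltW.
apply: (le_trans h1); rewrite ler_pM2l// kE.
have h3 : (2 - a) / S * V <= (2 - a) * (A / d%:R).
  by rewrite mulrAC -mulrA ler_wpM2l//; lra.
apply: (@le_trans _ _ ((1 - a) * A - (2 - a) * (A / d%:R))); last by rewrite lerB.
rewrite le_eqVlt; apply/orP; left; apply/eqP; field; lra.
Qed.

End inequalities.

(** * Integrals against the normal law *)

Section normal1.
Context {R : realType}.
Local Notation mu := (@lebesgue_measure R).
Import HBNNSimple.

Lemma lebesgue_measureD (c : R) (A : set R) : measurable A ->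
  pushforward mu ((fun x => x + c) : _ -> measurableTypeR R) A = mu A.
Proof.
move=> mA; have mD : @measurable_fun _ _ (measurableTypeR R) (measurableTypeR R) setT (fun x => x + c).
  exact: measurable_funD.
pose f : {mfun (measurableTypeR R) >-> (measurableTypeR R)} :=
  @mfun_Sub _ _ (measurableTypeR R) (measurableTypeR R) _ (mem_set mD).
apply/esym/(@lebesgue_measure_unique R (pushforward mu f)) => //= _ [[a b]] _ <-.
rewrite /pushforward.
have -> : (fun x : R => x + c) @^-1` `]a, b] = `](a - c)%R, (b - c)%R]%classic.
  by apply/seteqP; split => x /=; rewrite !in_itv/= ltrBlDr lerBrDr.
rewrite /= !lebesgue_measure_itv/= !lte_fin ltrD2r.
by case: ifP => // _; rewrite -!EFinB; congr EFin; ring.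
Qed.

Lemma ge0_integral_shift (c : R) (f : R -> \bar R) :
  measurable_fun [set: R] f -> (forall x, 0 <= f x)%E ->
  (\int[mu]_x f (x + c)%R = \int[mu]_x f x)%E.
Proof.
move=> mf f0.
have mD : measurable_fun [set: R] (fun x : R => x + c) by exact: measurable_funD.
have := @ge0_integral_pushforward _ _ (measurableTypeR R) (measurableTypeR R) R _ mD mu
  setT f measurableT mf (fun y _ => f0 y).
rewrite preimage_setT => <-.
by apply: eq_measure_integral => A mA _; exact: lebesgue_measureD.
Qed.

Lemma ge0_integral_oppr (f : R -> \bar R) :
  measurable_fun [set: R] f -> (forall x, 0 <= f x)%E ->
  (\int[mu]_x f (- x)%R = \int[mu]_x f x)%E.
Proof.
move=> mf f0.
have mD : measurable_fun [set: R] (fun x : R => - x) by exact: oppr_measurable.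
have := @ge0_integral_pushforward _ _ (measurableTypeR R) (measurableTypeR R) R _ mD mu
  setT f measurableT mf (fun y _ => f0 y).
rewrite preimage_setT => <-.
by apply: eq_measure_integral => A mA _; exact: lebesgue_measureN.
Qed.

(** True by hypothesis for indicators; extended to simple functions by linearity
    and to nonnegative functions by monotone convergence. *)
Lemma ge0_integral_density d (T : measurableType d) (nu lam : {measure set T -> \bar R})
    (h : T -> R) (f : T -> \bar R) :
  measurable_fun [set: T] h -> (forall x, 0 <= h x) ->
  (forall A, measurable A -> nu A = \int[lam]_(x in A) (h x)%:E)%E ->
  measurable_fun [set: T] f -> (forall x, 0 <= f x)%E ->
  (\int[nu]_x f x = \int[lam]_x (f x * (h x)%:E))%E.
Proof.
move=> mh h0 nuE mf f0; pose f_ := nnsfun_approx measurableT mf.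
transitivity (limn (fun n => \int[nu]_x (f_ n x)%:E))%E.
  rewrite -monotone_convergence//=.
  - apply: eq_integral => x _; apply/esym/cvg_lim => //=.
    exact: cvg_nnsfun_approx.
  - by move=> n; exact/measurable_EFinP.
  - by move=> n x _; rewrite lee_fin.
  - by move=> x _ a b ab; rewrite lee_fin; exact/lefP/nd_nnsfun_approx.
transitivity (limn (fun n => \int[lam]_x ((f_ n x)%:E * (h x)%:E)))%E; last first.
  rewrite -monotone_convergence//=.
  - apply: eq_integral => x _; apply/cvg_lim => //=.
    apply: cvgeZr => //.
    exact: cvg_nnsfun_approx.
  - by move=> n; apply: emeasurable_funM; exact/measurable_EFinP.
  - by move=> n x _; rewrite -EFinM lee_fin mulr_ge0.
  - move=> x _ a b ab; rewrite -!EFinM lee_fin ler_wpM2r//.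
    exact/lefP/nd_nnsfun_approx.
congr (limn _); apply/funext => n.
under eq_integral do rewrite fimfunE -fsumEFin//.
under [RHS]eq_integral => x _.
  rewrite fimfunE -fsumEFin//= ge0_mule_fsuml; last first.
    by move=> r; rewrite nnfun_muleindic_ge0.
  over.
rewrite !ge0_integral_fsum//=.
- apply: eq_fsbigr => r _.
  have [r0|r0] := ltP r 0.
    rewrite !integral0_eq// => x _.
      by rewrite preimage_nnfun0// indicE in_set0 mulr0 mul0e.
    by rewrite preimage_nnfun0// indicE in_set0 mulr0.
  under eq_integral do rewrite EFinM.
  rewrite ge0_integralZl//=; last by apply/measurable_EFinP.
  rewrite integral_indic// setIT.
  under [RHS]eq_integral do rewrite EFinM -muleA.
  rewrite ge0_integralZl//=.
  + congr (_ * _)%E; rewrite nuE// integral_mkcond.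
    apply: eq_integral => x _; rewrite patchE indicE.
    by case: ifP => _; rewrite ?mul1e ?mul0e.
  + by apply: emeasurable_funM; exact/measurable_EFinP.
  + by move=> x _; rewrite -EFinM lee_fin mulr_ge0.
- move=> r; apply: emeasurable_funM; last exact/measurable_EFinP.
  by apply/measurable_EFinP/measurable_funM.
- move=> r x _; rewrite mule_ge0 ?lee_fin//.
  exact: nnfun_muleindic_ge0.
- by move=> r; exact/measurable_EFinP/measurable_funM.
- by move=> r x _; exact: nnfun_muleindic_ge0.
Qed.

Lemma ge0_integral_normal (m s : R) (f : R -> \bar R) :
  measurable_fun [set: R] f -> (forall x, 0 <= f x)%E ->
  (\int[normal_prob m s]_x f x = \int[mu]_x (f x * (normal_pdf m s x)%:E))%E.
Proof.
move=> mf f0; apply: ge0_integral_density => //.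
- exact: measurable_normal_pdf.
- by move=> x; exact: normal_pdf_ge0.
Qed.

(** Of the two points [x] and [-x], the one on the same side as the mean [m] is
    the closer to [m]. *)
Lemma normal_pdf_sign (m s x : R) : s != 0 ->
  0 <= x * m * (normal_pdf m s x - normal_pdf m s (- x)).
Proof.
move=> s0; rewrite normal_pdfE//= -mulrBr mulrCA mulr_ge0 ?normal_peak_ge0//.
have s2 : 0 < s ^+ 2 *+ 2 by rewrite pmulrn_lgt0// exprn_even_gt0.
rewrite /normal_fun; have [xm|/ltW xm] := leP 0 (x * m).
  apply: mulr_ge0 => //; rewrite subr_ge0 ler_expR; apply: ler_wpM2r.
    by rewrite invr_ge0 ltW.
  rewrite lerN2; nra.
apply: mulr_le0 => //; rewrite subr_le0 ler_expR; apply: ler_wpM2r.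
  by rewrite invr_ge0 ltW.
rewrite lerN2; nra.
Qed.

(** Both integrals are symmetrized in [x]. Where [g x] is negative, the
    symmetrized integrands differ by
    [(g x * x)^2 (phi x + phi (-x)) - 2 g x * x m (phi x - phi (-x))],
    which is nonnegative by [normal_pdf_sign]. *)
Lemma positive_part_le (m s : R) (g : R -> R) : s != 0 ->
  measurable_fun [set: R] g -> (forall x, g (- x) = g x) ->
  (\int[normal_prob m s]_x ((Num.max 0 (g x) * x - m) ^+ 2)%:E <=
   \int[normal_prob m s]_x ((g x * x - m) ^+ 2)%:E)%E.
Proof.
move=> s0 mg ge.
have m1 : measurable_fun [set: R] (fun x => ((Num.max 0 (g x) * x - m) ^+ 2)).
  apply: measurable_funX; apply: measurable_funB => //; apply: measurable_funM => //.
  exact: measurable_maxr.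
have m2 : measurable_fun [set: R] (fun x => ((g x * x - m) ^+ 2)).
  by apply: measurable_funX; apply: measurable_funB => //; apply: measurable_funM.
have mp : measurable_fun [set: R] (normal_pdf m s) by exact: measurable_normal_pdf.
rewrite !ge0_integral_normal//; try exact/measurable_EFinP; try by move=> x; rewrite lee_fin sqr_ge0.
under eq_integral do rewrite -EFinM.
under [X in (_ <= X)%E]eq_integral do rewrite -EFinM.
have dbl (f : R -> R) : measurable_fun [set: R] f -> (forall x, 0 <= f x) ->
  (2%:E * \int[mu]_x (f x)%:E = \int[mu]_x (f x + f (- x))%:E)%E.
  move=> mf f0; under [RHS]eq_integral do rewrite EFinD.
  rewrite ge0_integralD//=; first last.
  - by apply/measurable_EFinP; apply: measurableT_comp => //; exact: oppr_measurable.
  - by move=> x _; rewrite lee_fin.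
  - exact/measurable_EFinP.
  - by move=> x _; rewrite lee_fin.
  rewrite (@ge0_integral_oppr (fun x => (f x)%:E))//; first by rewrite mule_natl mule2n.
  exact/measurable_EFinP.
rewrite -(@lee_pmul2l _ 2%:E)// !dbl; first last.
- by move=> x; rewrite mulr_ge0 ?sqr_ge0 ?normal_pdf_ge0.
- exact: measurable_funM.
- by move=> x; rewrite mulr_ge0 ?sqr_ge0 ?normal_pdf_ge0.
- exact: measurable_funM.
have me (f : R -> R) : measurable_fun [set: R] f ->
    measurable_fun [set: R] (fun x => (f x + f (- x))%:E).
  move=> mf; apply/measurable_EFinP; apply: measurable_funD => //.
  by apply: measurableT_comp => //; exact: oppr_measurable.
apply: ge0_le_integral => //=.
- by move=> x _; rewrite lee_fin addr_ge0// mulr_ge0 ?sqr_ge0 ?normal_pdf_ge0.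
- apply: (me (fun x => (Num.max 0 (g x) * x - m) ^+ 2 * normal_pdf m s x)).
  exact: measurable_funM.
- by apply: (me (fun x => (g x * x - m) ^+ 2 * normal_pdf m s x)); exact: measurable_funM.
move=> x _; rewrite lee_fin ge.
have [g0|g0] := leP 0 (g x); first by [].
have := @normal_pdf_sign m s x s0.
have := @normal_pdf_ge0 R m s x; have := @normal_pdf_ge0 R m s (- x).
set a := normal_pdf _ _ _; set b := normal_pdf _ _ x => a0 b0 h.
rewrite !mul0r.
have h2 : 0 <= - g x * (x * m * (b - a)) by rewrite mulr_ge0// oppr_ge0 ltW.
have h3 : 0 <= (g x * x) ^+ 2 * (a + b) by rewrite mulr_ge0 ?sqr_ge0 ?addr_ge0.
nra.
Qed.

End normal1.

(** * Stein's unbiased risk estimate in dimension one *)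

Section stein.
Context {R : realType}.
Local Notation mu := (@lebesgue_measure R).

Lemma is_derive_normal_pdf (m s x : R) : s != 0 ->
  is_derive x 1 (normal_pdf m s) (- ((x - m) / s ^+ 2) * normal_pdf m s x).
Proof.
move=> s0; rewrite normal_pdfE//= /normal_fun.
apply: is_derive_eq.
rewrite /GRing.scale/= !(mulr0,addr0,add0r,subr0,mulr1).
by field.
Qed.

(** From [v <= expR v] with [v = y^2 / (2 s^2)]; enough for boundary terms of
    linear growth to vanish at infinity. *)
Lemma normal_pdf_decay (m s y : R) : s != 0 ->
  normal_pdf m s (m + y) * y ^+ 2 <= normal_peak s * (s ^+ 2 *+ 2).
Proof.
move=> s0; rewrite normal_pdfE//= /normal_fun [m + y]addrC addrK -mulrA.
have s2 : 0 < s ^+ 2 *+ 2 by rewrite pmulrn_lgt0// exprn_even_gt0.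
apply: ler_wpM2l; first exact: normal_peak_ge0.
rewrite mulNr expRN mulrC ler_pdivrMr ?expR_gt0// mulrC -ler_pdivrMr//.
by rewrite (le_trans _ (expR_ge1Dx _))// lerDr.
Qed.

(** Stein's unbiased risk estimate in dimension one. The difference of the two
    integrands, multiplied by the density, is the derivative of
    [F x = s^2 (x - m + 2 G x) phi x], which tends to 0 at both ends. The
    fundamental theorem of calculus on [m - n, m + n] gives the result in the
    limit. The constant [C] makes the right-hand integrand nonnegative, so that
    monotone convergence applies to both sides and no integrability has to be
    known beforehand; the case of constant [G] gives the second moment. *)
Lemma normal_sure (m s C K : R) (G dG : R -> R) : s != 0 -> 0 <= C ->
  (forall x : R, is_derive x (1 : R) G (dG x)) -> continuous dG ->
  (forall x, `|G x| <= K) ->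
  (forall x, 0 <= s ^+ 2 + 2 * s ^+ 2 * dG x + G x ^+ 2 + C) ->
  (\int[normal_prob m s]_x ((x - m + G x) ^+ 2 + C)%:E =
   \int[normal_prob m s]_x (s ^+ 2 + 2 * s ^+ 2 * dG x + G x ^+ 2 + C)%:E)%E.
Proof.
move=> s0 C0 dGE cdG GK r0.
have s2 : 0 < s ^+ 2 by rewrite exprn_even_gt0.
set q := fun x => (x - m + G x) ^+ 2 + C.
set r := fun x => s ^+ 2 + 2 * s ^+ 2 * dG x + G x ^+ 2 + C.
have q0 x : 0 <= q x by rewrite addr_ge0// sqr_ge0.
have rr0 x : 0 <= r x by exact: r0.
pose phi := normal_pdf m s.
have phi0 x : 0 <= phi x by exact: normal_pdf_ge0.
have cG : continuous G.
  move=> x; apply: differentiable_continuous; apply/derivable1_diffP.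
  by have := dGE x; case.
have cphi : continuous phi by exact: continuous_normal_pdf.
have cq : continuous (fun x => q x * phi x).
  move=> x; apply: cvgM; last exact: cphi.
  apply: cvgD; last exact: cvg_cst.
  apply: (@continuous_comp _ _ _ (fun x => x - m + G x) (fun x => x ^+ 2)); last exact: sqr_continuous.
  apply: cvgD; last exact: cG.
  by apply: cvgB; [exact: cvg_id|exact: cvg_cst].
have cr : continuous (fun x => r x * phi x).
  move=> x; apply: cvgM; last exact: cphi.
  apply: cvgD; last exact: cvg_cst.
  apply: cvgD.
    apply: cvgD; first exact: cvg_cst.
    by apply: cvgM; [exact: cvg_cst|exact: cdG].
  apply: (@continuous_comp _ _ _ G (fun x => x ^+ 2)); last exact: sqr_continuous.
  exact: cG.
pose F x := s ^+ 2 * (x - m + 2 * G x) * phi x.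
have dF (x : R) : is_derive x (1 : R) F (r x * phi x - q x * phi x).
  have h1 := is_derive_normal_pdf m s x s0; have h2 := dGE x.
  have h3 : is_derive x (1 : R) (fun x : R => s ^+ 2 * (x - m + 2 * G x)) (s ^+ 2 * (1 + 2 * dG x)).
    apply: is_derive_eq.
    rewrite /GRing.scale/= !(mulr0,addr0,add0r,subr0,mulr1,scaler0); ring.
  have := is_deriveM h3 h1.
  rewrite /F => h; apply: (is_derive_eq h).
  rewrite /GRing.scale/= -/phi /r /q; field.
  exact: s0.
pose D (n : nat) : set R := `[m - n.+1%:R, m + n.+1%:R]%classic.
have mD n : measurable (D n) by exact: measurable_itv.
have DT : \bigcup_n D n = setT.
  apply/seteqP; split => // x _; exists (Num.truncn `|x - m|) => //.
  have := truncnS_gt `|x - m|; rewrite /D/= in_itv/= ltr_norml => /andP[h1 h2].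
  by apply/andP; split; lra.
have Dnd : {homo D : n k / (n <= k)%N >-> (n <= k)%O}.
  move=> n k nk; apply/subsetPset => x; rewrite /D/= !in_itv/= => /andP[h1 h2].
  have : n.+1%:R <= k.+1%:R :> R by rewrite ler_nat ltnS.
  by move=> h; apply/andP; split; lra.
have mc (h : R -> R) : continuous h -> measurable_fun [set: R] (fun x => (h x)%:E).
  by move=> ch; apply/measurable_EFinP; exact: continuous_measurable_fun.
have cvI (h : R -> R) : continuous h -> (forall x, 0 <= h x) ->
   (\int[mu]_(x in D n) (h x)%:E @[n --> \oo] --> \int[mu]_x (h x)%:E)%E.
  move=> ch h0; rewrite -[in X in _ --> X]DT.
  apply: ge0_nondecreasing_set_cvg_integral => //.
  - by move=> n; apply: measurable_funTS; exact: mc.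
  - by move=> n x _; rewrite lee_fin.
have intD (h : R -> R) n : continuous h -> mu.-integrable (D n) (EFin \o h).
  move=> ch; apply: continuous_compact_integrable; first exact: segment_compact.
  exact: continuous_subspaceT.
have key n : (\int[mu]_(x in D n) (r x * phi x)%:E = \int[mu]_(x in D n) (q x * phi x)%:E
     + (F (m + n.+1%:R) - F (m - n.+1%:R))%:E)%E.
  have cf : continuous (fun x => r x * phi x - q x * phi x).
    by move=> x; apply: cvgB; [exact: cr|exact: cq].
  rewrite EFinB -(@continuous_FTC2 _ (fun x => r x * phi x - q x * phi x)).
  - rewrite -/(D n) -(integralD _ (intD _ n cq) (intD _ n cf)); last exact: measurable_itv.
    by apply: eq_integral => x _; rewrite -EFinD; congr EFin; ring.
  - by rewrite ltrBlDr -addrA ltrDl -natrD.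
  - exact: continuous_subspaceT.
  - have cF : continuous F.
      by move=> x; apply: differentiable_continuous; apply/derivable1_diffP; case: (dF x).
    split.
    + by move=> x _; case: (dF x).
    + by apply: cvg_at_right_filter; exact: cF.
    + by apply: cvg_at_left_filter; exact: cF.
  - by move=> x _; rewrite derive1E; case: (dF x) => _ ->.
have bF n : `|F (m + n.+1%:R) - F (m - n.+1%:R)| <=
    2 * (s ^+ 2 * (1 + 2 * K) * (normal_peak s * (s ^+ 2 *+ 2))) * harmonic n.
  have K0 : 0 <= K by rewrite (le_trans _ (GK 0)).
  have N1 : 1 <= n.+1%:R :> R by rewrite ler1n.
  have one (y : R) : `|y| = n.+1%:R -> `|F (m + y)| <=
     s ^+ 2 * (1 + 2 * K) * (normal_peak s * (s ^+ 2 *+ 2)) * harmonic n.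
    move=> yn; rewrite /F [m + y]addrC addrK 2!normrM (ger0_norm (ltW s2)) (ger0_norm (phi0 _)).
    rewrite [leLHS](_ : _ = s ^+ 2 * (`|y + 2 * G (y + m)| * phi (y + m))); last ring.
    rewrite /harmonic/=.
    rewrite [leRHS](_ : _ = s ^+ 2 * ((1 + 2 * K) * (normal_peak s * (s ^+ 2 *+ 2)) / n.+1%:R)); last ring.
    rewrite ler_pM2l//.
    have h : `|y + 2 * G (y + m)| <= (1 + 2 * K) * n.+1%:R.
      rewrite (le_trans (ler_normD _ _))// yn normrM ger0_norm//.
      have := GK (y + m); nra.
    have h2 := normal_pdf_decay m s y s0.
    rewrite ler_pdivlMr; last by rewrite ltr0n.
    apply: (@le_trans _ _ ((1 + 2 * K) * n.+1%:R * phi (y + m) * n.+1%:R)).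
      by rewrite ler_wpM2r// ler_wpM2r.
    rewrite (_ : _ * n.+1%:R = (1 + 2 * K) * (phi (y + m) * n.+1%:R ^+ 2)); last ring.
    apply: ler_wpM2l; first lra.
    by move: h2; rewrite [m + y]addrC -/phi -[y ^+ 2]real_normK ?num_real// yn.
  rewrite (le_trans (ler_normB _ _))// -mulrA mulr_natl mulr2n lerD// one//.
    by rewrite ger0_norm.
  by rewrite normrN ger0_norm.
have cvF : ((F (m + n.+1%:R) - F (m - n.+1%:R))%:E @[n --> \oo] --> 0%:E)%E.
  apply: cvg_EFin; first exact: nearW.
  apply/norm_cvg0P.
  set c0 := 2 * _ in bF.
  apply: (@squeeze_cvgr _ _ _ _ (fun=> 0) (fun n => c0 * harmonic n)).
  - by apply: nearW => n; rewrite normr_ge0/= bF.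
  - exact: cvg_cst.
  - rewrite -(mulr0 c0); apply: cvgM; [exact: cvg_cst|exact: cvg_harmonic].
have e : (\int[mu]_x (q x * phi x)%:E = \int[mu]_x (r x * phi x)%:E)%E.
  have c1 : (\int[mu]_(x in D n) (r x * phi x)%:E @[n --> \oo] --> \int[mu]_x (q x * phi x)%:E + 0)%E.
    under eq_fun do rewrite key.
    apply: cvgeD => //; first by rewrite fin_num_adde_defl.
    by apply: cvI => // x; rewrite mulr_ge0.
  have c2 : (\int[mu]_(x in D n) (r x * phi x)%:E @[n --> \oo] --> \int[mu]_x (r x * phi x)%:E)%E.
    by apply: cvI => // x; rewrite mulr_ge0.
  by rewrite -[LHS]adde0; apply: (cvg_unique _ c1 c2).
have mq : measurable_fun [set: R] q.
  apply: measurable_funD => //; apply: measurable_funX; apply: measurable_funD.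
    exact: measurable_funB.
  exact: continuous_measurable_fun.
have mr : measurable_fun [set: R] r.
  apply: measurable_funD => //; apply: measurable_funD.
    apply: measurable_funD => //; apply: measurable_funM => //.
    exact: continuous_measurable_fun.
  by apply: measurable_funX; exact: continuous_measurable_fun.
rewrite !ge0_integral_normal//; try exact/measurable_EFinP; try by move=> x; rewrite lee_fin.
Qed.

End stein.

(** * Laws on vectors: boxes and resampling *)

Section boxes.
Context {R : realType} {d : nat}.

Definition update (z : d.-tuple R) (i : 'I_d) (x : R) : d.-tuple R :=
  [tuple if j == i then x else tnth z j | j < d].

Lemma tnth_update z i x j : tnth (update z i x) j = if j == i then x else tnth z j.
Proof. by rewrite tnth_mktuple. Qed.

Lemma measurable_update i :
  measurable_fun [set: d.-tuple R * R] (fun w => update w.1 i w.2).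
Proof.
apply/measurable_fun_tnthP => j.
have [->|ji] := eqVneq j i.
  rewrite (_ : _ \o _ = snd) //.
  by apply/funext => w /=; rewrite tnth_update eqxx.
rewrite (_ : _ \o _ = (fun z => tnth z j) \o fst).
  by apply: measurableT_comp => //; exact: measurable_tnth.
by apply/funext => w /=; rewrite tnth_update (negbTE ji).
Qed.

Lemma measurable_updater z i : measurable_fun [set: R] (fun x => update z i x).
Proof. exact: (measurableT_comp (measurable_update i) (measurable_pair1 z)). Qed.

Definition box (B : 'I_d -> set R) : set (d.-tuple R) :=
  [set z | forall i, B i (tnth z i)].

Lemma measurable_box (B : 'I_d -> set R) : (forall i, measurable (B i)) -> measurable (box B).
Proof.
move=> mB.
have -> : box B = \bigcap_(i in [set: 'I_d]) ((fun z : d.-tuple R => tnth z i) @^-1` B i).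
  by apply/seteqP; split => z /= h i; [move=> _; exact: h|exact: h].
apply: fin_bigcap_measurable; first exact: finite_finset.
by move=> i _; rewrite -[X in measurable X]setTI; exact: measurable_tnth.
Qed.

(** Preimages under a coordinate generate the sigma-algebra of tuples, and they
    are boxes with all other sides equal to the whole line. *)
Lemma measurable_tuple_boxes :
  @measurable _ (d.-tuple R) = <<s [set box B | B in [set B | forall i, measurable (B i)]] >>.
Proof.
apply/seteqP; split.
  apply: smallest_sub; first exact: smallest_sigma_algebra.
  rewrite -bigcup_seq => A [i _ [B mB <-]].
  apply: sub_sigma_algebra; exists (fun j => if j == i then B else setT).
    by move=> j; case: eqP.
  apply/seteqP; split => z /=.
    by move=> /(_ i); rewrite eqxx.
  by move=> [_ h] j; case: eqP => // ->.
apply: smallest_sub; first exact: sigma_algebra_measurable.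
by move=> A [B mB <-]; exact: measurable_box.
Qed.

(** Boxes form a generating family closed under intersection. *)
Lemma box_measure_unique (m1 m2 : {measure set (d.-tuple R) -> \bar R}) :
  (m1 setT < +oo)%E ->
  (forall B, (forall i, measurable (B i)) -> m1 (box B) = m2 (box B)) ->
  forall A, measurable A -> m1 A = m2 A.
Proof.
move=> m1oo m12.
apply: (measure_unique [set box B | B in [set B | forall i, measurable (B i)]] (fun=> setT)).
- exact: measurable_tuple_boxes.
- move=> _ _ [B mB <-] [C mC <-]; exists (fun i => B i `&` C i).
    by move=> i; exact: measurableI.
  apply/seteqP; split => z /=.
    by move=> h; split => i; case: (h i).
  by move=> [h1 h2] i; split; [exact: h1|exact: h2].
- move=> _; exists (fun=> setT) => //.
  by apply/seteqP; split.
- by rewrite bigcup_const//; exists 0%N.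
- by move=> _ [B mB <-]; exact: m12.
- by [].
Qed.

(** The condition of [normal_vector], stated for a law on vectors instead of a
    random vector. *)
Definition normal_law (Q : set (d.-tuple R) -> \bar R) (theta : d.-tuple R) (sigma : R) :=
  forall B, (forall i, measurable (B i)) ->
    (Q (box B) = \prod_(i < d) normal_prob (tnth theta i) sigma (B i))%E.

(** The image of [Q x N(theta_i, sigma^2)] under the replacement of the [i]-th
    coordinate has the same values on boxes as [Q], hence is [Q]. *)
Lemma resample (Q : probability (d.-tuple R) R) theta sigma i (f : d.-tuple R -> \bar R) :
  normal_law Q theta sigma -> measurable_fun setT f -> (forall z, 0 <= f z)%E ->
  (\int[Q]_z f z = \int[Q]_z \int[normal_prob (tnth theta i) sigma]_x f (update z i x))%E.
Proof.
move=> hQ mf f0.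
pose N : probability (measurableTypeR R) R := normal_prob (tnth theta i) sigma.
have mu_ := measurable_update i.
pose phi : {mfun (d.-tuple R * measurableTypeR R)%type >-> d.-tuple R} :=
  @mfun_Sub _ _ (d.-tuple R * measurableTypeR R)%type (d.-tuple R) _ (mem_set mu_).
pose M := pushforward (Q \x N)%E phi.
have QM A : measurable A -> Q A = M A.
  apply: (@box_measure_unique Q (pushforward (Q \x N)%E phi)).
    by apply: (@le_lt_trans _ _ 1%E); [exact: probability_le1|exact: ltry].
  move=> B mB; transitivity (\prod_(j < d) normal_prob (tnth theta j) sigma (B j))%E.
    exact: hQ.
  have phiB : phi @^-1` box B = box (fun j => if j == i then setT else B j) `*` B i.
    apply/seteqP; split => -[z x]; rewrite /phi/=.
      move=> h; split => /=.
        by move=> j; have := h j; rewrite tnth_update; case: eqP.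
      by have := h i; rewrite tnth_update eqxx.
    by move=> [/= h1 h2] j; have := h1 j; rewrite tnth_update; case: eqP => // ->.
  have mB' j : measurable (if j == i then setT else B j) by case: eqP.
  transitivity (Q (box (fun j => if j == i then setT else B j)) * N (B i))%E; last first.
    transitivity ((Q \x N)%E (box (fun j => if j == i then setT else B j) `*` B i)).
      apply: esym; apply: (@product_measure1E _ _ (d.-tuple R) (measurableTypeR R) R Q N).
        exact: measurable_box.
      exact: mB.
    by rewrite -phiB.
  rewrite hQ// (bigD1 i)//= [in RHS](bigD1 i)//= eqxx.
  rewrite [X in (X * _ * _)%E](_ : _ = 1%E); last exact: (@probability_setT _ _ _ N).
  by rewrite mul1e muleC; congr (_ * _)%E; apply: eq_bigr => j /negbTE ->.
transitivity (\int[M]_z f z)%E.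
  by apply: eq_measure_integral => A mA _; exact: QM.
rewrite ge0_integral_pushforward// preimage_setT.
rewrite (@fubini_tonelli1 _ _ _ _ _ Q N)//.
  exact: measurableT_comp.
by move=> x; exact: f0.
Qed.

(** Inequalities between expectations under [Q] follow from inequalities in one
    coordinate, the others being fixed. *)
Lemma resample_le (Q : probability (d.-tuple R) R) theta sigma i (f g : d.-tuple R -> \bar R) :
  normal_law Q theta sigma -> measurable_fun setT f -> (forall z, 0 <= f z)%E ->
  measurable_fun setT g -> (forall z, 0 <= g z)%E ->
  (forall z, \int[normal_prob (tnth theta i) sigma]_x f (update z i x) <=
     \int[normal_prob (tnth theta i) sigma]_x g (update z i x))%E ->
  (\int[Q]_z f z <= \int[Q]_z g z)%E.
Proof.
move=> hQ mf f0 mg g0 fg.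
rewrite (resample Q theta sigma i f)// (resample Q theta sigma i g)//.
have mI (h : d.-tuple R -> \bar R) : measurable_fun setT h -> (forall z, 0 <= h z)%E ->
  measurable_fun setT (fun z => \int[normal_prob (tnth theta i) sigma]_x h (update z i x))%E.
  move=> mh h0.
  apply: (@measurable_fun_fubini_tonelli_F _ _ (d.-tuple R) (measurableTypeR R) R
    (normal_prob (tnth theta i) sigma) (fun w => h (update w.1 i w.2))) => //.
  exact: (measurableT_comp mh (measurable_update i)).
apply: ge0_le_integral => //.
- by move=> z _; apply: integral_ge0.
- exact: mI.
- exact: mI.
Qed.

End boxes.

(** * The regularized shrinkage weight in one coordinate *)

Section powR_calculus.
Context {R : realType}.

Lemma le_sqr_add1 (u : R) : u <= u ^+ 2 + 1.
Proof. have := sqr_ge0 (u - 2^-1); nra. Qed.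

Lemma is_derive1_powR (f : R -> R) (x df r : R) : 0 < f x ->
  is_derive x (1 : R) f df ->
  is_derive x (1 : R) (fun y => f y `^ r) (r * f x `^ (r - 1) * df).
Proof.
move=> f0 hf.
have fx : f x \in `]0, +oo[ by rewrite in_itv/= f0.
have h : is_derive (f x) (1 : R) ((@powR R) ^~ r) (r * f x `^ (r - 1)).
  apply: DeriveDef; first exact: derivable_powR.
  by rewrite -derive1E powR_derive1.
exact: is_derive1_comp.
Qed.

Lemma continuous_powR_comp (f : R -> R) (r x : R) : 0 < f x ->
  {for x, continuous f} -> {for x, continuous (fun y => f y `^ r)}.
Proof.
move=> f0 cf.
apply: (@continuous_comp _ _ _ f (fun y => y `^ r)) => //.
apply: differentiable_continuous; apply/derivable1_diffP.
by apply: derivable_powR; rewrite in_itv/= f0.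
Qed.

End powR_calculus.

Section coordinate.
Context {R : realType}.
Variables (p a e A : R).
Hypotheses (p0 : 0 < p) (a0 : 0 <= a) (a1 : a < 1) (e0 : 0 < e) (A0 : 0 <= A).

Let t (x : R) := x ^+ 2 + e.
Let S (x : R) := A + t x `^ (p / 2).
(** The regularized shrinkage weight as a function of one coordinate [x]; [A]
    is the contribution of the other coordinates to the regularized power sum. *)
Definition shrink1 (x : R) := S x `^ ((a - 2) / p) * t x `^ (- (a / 2)).
(** The derivative of [x * shrink1 x] ([is_derive_shrink1]). Inverses are written
    as powers with exponent -1, for which measurability is at hand. *)
Definition dshrink1 (x : R) := shrink1 x *
  (1 - x ^+ 2 * t x `^ (-1) * (a + (2 - a) * (t x `^ (p / 2) * S x `^ (-1)))).

Let a2 : 0 <= 2 - a.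
Proof. by rewrite subr_ge0 (le_trans (ltW a1))// ler1n. Qed.
Let t0 x : 0 < t x. Proof. by rewrite ltr_wpDl// sqr_ge0. Qed.
Let S0 x : 0 < S x. Proof. by rewrite ltr_wpDl// powR_gt0. Qed.

Lemma is_derive_shrink1 (x : R) :
  is_derive x (1 : R) (fun x => x * shrink1 x) (dshrink1 x).
Proof.
have ht : is_derive x (1 : R) t (2 * x).
  apply: is_derive_eq.
  rewrite /GRing.scale/= !(mulr0,addr0,mulr1); ring.
have hp := is_derive1_powR t x (2 * x) (p / 2) (t0 x) ht.
have hS : is_derive x (1 : R) S (p / 2 * t x `^ (p / 2 - 1) * (2 * x)).
  by apply: (is_derive_eq (is_deriveD (is_derive_cst A x (1 : R)) hp)); rewrite add0r.
have h1 := is_derive1_powR S x _ ((a - 2) / p) (S0 x) hS.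
have h2 := is_derive1_powR t x _ (- (a / 2)) (t0 x) ht.
have h := is_deriveM (is_derive_id x (1 : R)) (is_deriveM h1 h2).
apply: (is_derive_eq h).
rewrite /GRing.scale/= /dshrink1 /shrink1 fctE.
have tn0 : t x != 0 by rewrite gt_eqF.
have Sn0 : S x != 0 by rewrite gt_eqF.
rewrite !powRB ?tn0 ?Sn0 ?implybT// !powRr1 ?ltW// !powR_inv1 ?ltW//.
field.
by rewrite tn0 Sn0 gt_eqF.
Qed.

Let ct : continuous t.
Proof. by move=> x; apply: cvgD; [exact: sqr_continuous|exact: cvg_cst]. Qed.

Let cS : continuous S.
Proof.
move=> x; apply: cvgD; first exact: cvg_cst.
exact: (continuous_powR_comp t (p / 2) x (t0 x) (ct x)).
Qed.

Lemma continuous_dshrink1 : continuous dshrink1.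
Proof.
move=> x.
have c1 r := continuous_powR_comp t r x (t0 x) (ct x).
have c2 r := continuous_powR_comp S r x (S0 x) (cS x).
apply: cvgM; first by apply: cvgM; [exact: c2|exact: c1].
apply: cvgB; first exact: cvg_cst.
apply: cvgM.
  by apply: cvgM; [exact: sqr_continuous|exact: c1].
apply: cvgD; first exact: cvg_cst.
apply: cvgM; first exact: cvg_cst.
by apply: cvgM; [exact: c1|exact: c2].
Qed.

Lemma shrink1_gt0 x : 0 < shrink1 x.
Proof. by rewrite mulr_gt0 ?powR_gt0. Qed.

(** [S x] dominates its summand [t x `^ (p / 2)] and is raised to a negative
    power. *)
Lemma shrink1_le x : shrink1 x <= (t x)^-1.
Proof.
have -> : (t x)^-1 = (t x `^ (p / 2)) `^ ((a - 2) / p) * t x `^ (- (a / 2)).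
  rewrite -powRrM -powRD; last by rewrite (gt_eqF (t0 x)) implybT.
  rewrite -powR_inv1 ?(ltW (t0 x))//; congr (_ `^ _); field; exact: lt0r_neq0.
rewrite ler_wpM2r ?powR_ge0//.
rewrite (_ : (a - 2) / p = - ((2 - a) / p)); last by rewrite -mulNr opprB.
rewrite !powRN lef_pV2 ?posrE ?powR_gt0//.
apply: ge0_ler_powR; rewrite ?nnegrE ?powR_ge0 ?(ltW (S0 x))//.
  by rewrite divr_ge0// ltW.
by rewrite /S lerDr.
Qed.

Lemma dshrink1_le x : dshrink1 x <= e^-1.
Proof.
have u0 : 0 <= x ^+ 2 * t x `^ (-1) * (a + (2 - a) * (t x `^ (p / 2) * S x `^ (-1))).
  apply: mulr_ge0; first by rewrite mulr_ge0 ?sqr_ge0 ?powR_ge0.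
  by rewrite addr_ge0// !mulr_ge0 ?powR_ge0.
have te : (t x)^-1 <= e^-1 by rewrite lef_pV2 ?posrE// lerDr sqr_ge0.
apply: le_trans te; apply: le_trans (shrink1_le x).
by apply: ler_piMr; [exact/ltW/shrink1_gt0|rewrite lerBlDr lerDl].
Qed.

(** The step where regularizing is harmless: [x^2 / (x^2 + e)] is at most 1. *)
Lemma dshrink1_ge x :
  shrink1 x * (1 - a - (2 - a) * (t x `^ (p / 2) / S x)) <= dshrink1 x.
Proof.
rewrite /dshrink1 ler_pM2l ?shrink1_gt0// -addrA lerD2l -opprD lerN2.
rewrite !powR_inv1 ?(ltW (t0 x)) ?(ltW (S0 x))//.
apply: ler_piMl.
  rewrite addr_ge0// mulr_ge0//.
  by rewrite divr_ge0 ?powR_ge0// ltW.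
by rewrite ler_pdivrMr// mul1r lerDl ltW.
Qed.

Lemma xshrink1_bound x : `|x * shrink1 x| <= 1 + e^-1.
Proof.
rewrite normrM (ger0_norm (ltW (shrink1_gt0 x))).
apply: (@le_trans _ _ (`|x| * (t x)^-1)).
  by rewrite ler_wpM2l// shrink1_le.
rewrite ler_pdivrMr//.
have e1 : e * e^-1 = 1 by rewrite mulfV// gt_eqF.
have -> : (1 + e^-1) * t x = t x + e^-1 * x ^+ 2 + 1 by rewrite /t -{2}e1; ring.
have h : 0 <= e^-1 * x ^+ 2 by rewrite mulr_ge0 ?sqr_ge0// invr_ge0 ltW.
rewrite /t -[x ^+ 2]real_normK ?num_real// in h *.
have h1 : `|x| <= `|x| ^+ 2 + 1.
  exact: le_sqr_add1.
by apply: (le_trans h1); rewrite lerD2r -addrA lerDl addr_ge0// ltW.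
Qed.

End coordinate.

(** * Risk of the regularized estimator *)

Section regularized.
Context {R : realType}.

(** One-dimensional comparison: remove the positive part, then apply Stein's
    identity with [G x = - k x (shrink1 x)]. The constant [C] compensates the
    bound [e^-1] of [dshrink1]. *)
Lemma coordinate_risk (p a e A k m s C : R) :
  0 < p -> 0 <= a -> a < 1 -> 0 < e -> 0 <= A -> 0 < k -> 0 < s ->
  C = 2 * s ^+ 2 * (k * e^-1) ->
  (\int[normal_prob m s]_x
     ((Num.max 0 (1 - k * shrink1 p a e A x) * x - m) ^+ 2 + C)%:E <=
   \int[normal_prob m s]_x
     (s ^+ 2 + 2 * s ^+ 2 * (- k * dshrink1 p a e A x) +
       (- k * (x * shrink1 p a e A x)) ^+ 2 + C)%:E)%E.
Proof.
move=> p0 a0 a1 e0 A0 k0 s0 CE.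
have sn0 : s != 0 by rewrite gt_eqF.
have C0 : 0 <= C by rewrite CE !mulr_ge0 ?sqr_ge0 ?invr_ge0 ?ltW.
pose G x := - k * (x * shrink1 p a e A x).
have dG (x : R) : is_derive x (1 : R) G (- k * dshrink1 p a e A x).
  by have h := is_derive_shrink1 p a e A p0 e0 A0 x; apply: is_deriveZ.
have mg : measurable_fun [set: R] (fun x => 1 - k * shrink1 p a e A x).
  have mt : measurable_fun [set: R] (fun x : R => x ^+ 2 + e).
    by apply: measurable_funD => //; exact: measurable_funX.
  have mpt r : measurable_fun [set: R] (fun x : R => (x ^+ 2 + e) `^ r).
    by apply: (measurableT_comp (measurable_powR r)).
  apply: measurable_funB => //; apply: measurable_funM => //.
  apply: measurable_funM; last exact: mpt.
  apply: (measurableT_comp (measurable_powR _)).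
  by apply: measurable_funD => //; exact: mpt.
have ev x : 1 - k * shrink1 p a e A (- x) = 1 - k * shrink1 p a e A x.
  by rewrite /shrink1 sqrrN.
have addC (f : R -> R) : measurable_fun [set: R] f -> (forall x, 0 <= f x) ->
   (\int[normal_prob m s]_x (f x + C)%:E = \int[normal_prob m s]_x (f x)%:E + C%:E)%E.
  move=> mf f0; under eq_integral do rewrite EFinD.
  rewrite ge0_integralD//.
  - by rewrite integral_cst// [X in (_ * X)%E](_ : _ = 1%E) ?mule1//; exact: probability_setT.
  - by move=> x _; rewrite lee_fin.
  - exact/measurable_EFinP.
have := @normal_sure R m s C (k * (1 + e^-1)) G (fun x => - k * dshrink1 p a e A x) sn0 C0 dG.
move=> <-; first last.
- move=> x; rewrite CE.
  have h := dshrink1_le p a e A p0 a0 a1 e0 A0 x.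
  have h2 : k * dshrink1 p a e A x <= k * e^-1 by rewrite ler_pM2l.
  have h3 : 0 <= 2 * s ^+ 2 * (k * e^-1 - k * dshrink1 p a e A x).
    by rewrite mulr_ge0 ?subr_ge0// mulr_ge0 ?sqr_ge0.
  have := sqr_ge0 s; have := sqr_ge0 (G x).
  nra.
- move=> x; rewrite /G normrM normrN (ger0_norm (ltW k0)) ler_pM2l//.
  exact: xshrink1_bound.
- move=> x; apply: cvgM; first exact: cvg_cst.
  exact: continuous_dshrink1.
have -> : (\int[normal_prob m s]_x ((x - m + G x) ^+ 2 + C)%:E =
   \int[normal_prob m s]_x (((1 - k * shrink1 p a e A x) * x - m) ^+ 2 + C)%:E)%E.
  by apply: eq_integral => x _; congr EFin; rewrite /G; ring.
rewrite !addC.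
- by rewrite leeD2r//; apply: positive_part_le.
- by apply: measurable_funX; apply: measurable_funB => //; apply: measurable_funM.
- by move=> x; exact: sqr_ge0.
- apply: measurable_funX; apply: measurable_funB => //; apply: measurable_funM => //.
  exact: measurable_maxr.
- by move=> x; exact: sqr_ge0.
Qed.

Variables (d : nat) (p a c s e : R).
Hypotheses (d3 : (3 <= d)%N) (p0 : 0 < p) (a0 : 0 <= a).
Hypothesis a1 : a < (d%:R - 2) / (d%:R - 1).
Hypotheses (c0 : 0 < c) (hc : c <= 2 * (d%:R - 2) * gamma_const d p a).
Hypotheses (s0 : 0 < s) (e0 : 0 < e).

Definition reg_rest (z : d.-tuple R) (i : 'I_d) : R :=
  \sum_(j < d | j != i) (tnth z j ^+ 2 + e) `^ (p / 2).
Definition reg_shrink (z : d.-tuple R) (i : 'I_d) : R :=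
  shrink1 p a e (reg_rest z i) (tnth z i).
Definition reg_dshrink (z : d.-tuple R) (i : 'I_d) : R :=
  dshrink1 p a e (reg_rest z i) (tnth z i).

Let alt1 : a < 1.
Proof.
have d3R : 3 <= d%:R :> R by rewrite ler_nat.
apply: (lt_trans a1); rewrite ltr_pdivrMr ?mul1r ?ltrD2l ?ltrN2 ?ltr1n//.
by rewrite subr_gt0 (lt_le_trans _ d3R)// ltr1n.
Qed.

Let k := c * s ^+ 2.
Let k0 : 0 < k. Proof. by rewrite mulr_gt0// exprn_gt0. Qed.

Let rest_ge0 z i : 0 <= reg_rest z i.
Proof. by apply: sumr_ge0 => j _; exact: powR_ge0. Qed.

Let rest_update z i x : reg_rest (update z i x) i = reg_rest z i.
Proof. by apply: eq_bigr => j ji; rewrite tnth_update (negbTE ji). Qed.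

Lemma reg_sum z i : reg_rest z i + (tnth z i ^+ 2 + e) `^ (p / 2) =
  \sum_(j < d) (tnth z j ^+ 2 + e) `^ (p / 2).
Proof. by rewrite [RHS](bigD1 i)//= addrC. Qed.

Lemma measurable_reg_t r j :
  measurable_fun [set: d.-tuple R] (fun z : d.-tuple R => (tnth z j ^+ 2 + e) `^ r).
Proof.
apply: (measurableT_comp (measurable_powR r)).
apply: measurable_funD => //; apply: measurable_funX; exact: measurable_tnth.
Qed.

Lemma measurable_reg_sum r i :
  measurable_fun [set: d.-tuple R]
   (fun z : d.-tuple R => (reg_rest z i + (tnth z i ^+ 2 + e) `^ (p / 2)) `^ r).
Proof.
apply: (measurableT_comp (measurable_powR r)).
under eq_fun do rewrite reg_sum.
by apply: measurable_sum => j; exact: measurable_reg_t.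
Qed.

Lemma measurable_reg_shrink i : measurable_fun [set: d.-tuple R] (fun z => reg_shrink z i).
Proof.
by apply: measurable_funM; [exact: measurable_reg_sum|exact: measurable_reg_t].
Qed.

Lemma measurable_reg_dshrink i : measurable_fun [set: d.-tuple R] (fun z => reg_dshrink z i).
Proof.
apply: measurable_funM; first exact: measurable_reg_shrink.
apply: measurable_funB => //; apply: measurable_funM.
  apply: measurable_funM; last exact: measurable_reg_t.
  by apply: measurable_funX; exact: measurable_tnth.
apply: measurable_funD => //; apply: measurable_funM => //.
by apply: measurable_funM; [exact: measurable_reg_t|exact: measurable_reg_sum].
Qed.

(** Stein's unbiased estimate of the risk of the [i]-th coordinate, the
    right-hand side of [normal_sure]. *)
Definition unbiased_risk (z : d.-tuple R) (i : 'I_d) : R :=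
  s ^+ 2 + 2 * s ^+ 2 * (- k * reg_dshrink z i) + (- k * (tnth z i * reg_shrink z i)) ^+ 2.

(** [dshrink1_ge] and [z_i^2 <= t_i] reduce the claim to
    [shrinkage_inequality] for [t_i = z_i^2 + e], multiplied by a positive
    factor. *)
Lemma sum_unbiased_risk_le z : \sum_(i < d) unbiased_risk z i <= d%:R * s ^+ 2.
Proof.
pose t i := tnth z i ^+ 2 + e.
have t0 i : 0 < t i by rewrite ltr_wpDl// sqr_ge0.
pose S := \sum_(i < d) t i `^ (p / 2).
have := @shrinkage_inequality R d p a c S t d3 p0 a0 a1 c0 hc t0 erefl.
set U := \sum_i t i `^ (1 - a); set W := \sum_i _ => key.
have S0 : 0 < S `^ ((a - 2) / p).
  apply: powR_gt0; rewrite /S -(reg_sum z (Ordinal (ltn_trans (ltn0Sn 1) d3))).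
  by apply: ltr_wpDl; [exact: rest_ge0|exact: (powR_gt0 _ (t0 _))].
have bnd i : unbiased_risk z i <= s ^+ 2 +
   (- (2 * s ^+ 2 * k)) * (S `^ ((a - 2) / p) *
      (t i `^ (- (a / 2)) * (1 - a - (2 - a) * (t i `^ (p / 2) / S)))) +
   k ^+ 2 * (S `^ ((a - 2) / p) * (S `^ ((a - 2) / p) * t i `^ (1 - a))).
  have h1 := @dshrink1_ge R p a e (reg_rest z i) a0 alt1 e0 (rest_ge0 z i) (tnth z i).
  have hsE : reg_shrink z i = S `^ ((a - 2) / p) * t i `^ (- (a / 2)).
    by rewrite /reg_shrink /shrink1 reg_sum.
  rewrite -/(reg_shrink z i) -/(reg_dshrink z i) reg_sum hsE -/(t i) -/S in h1.
  rewrite /unbiased_risk hsE; apply: lerD.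
    rewrite lerD2l mulNr mulrN -mulrA -mulNr -mulNr.
    rewrite !mulNr lerN2 mulrA [leRHS]mulrA.
    rewrite ler_wpM2l//; last by rewrite mulrA.
    by rewrite mulr_ge0 ?mulr_ge0 ?sqr_ge0// ltW.
  rewrite exprMn sqrrN; apply: ler_wpM2l; first exact: sqr_ge0.
  have -> : t i `^ (1 - a) = t i * (t i `^ (- (a / 2))) ^+ 2.
    rewrite expr2 -powRD; last by rewrite (gt_eqF (t0 i)) implybT.
    rewrite -{2}(powRr1 (ltW (t0 i))) -powRD; last by rewrite (gt_eqF (t0 i)) implybT.
    by congr (_ `^ _); field.
  rewrite [leRHS](_ : _ = (S `^ ((a - 2) / p) * t i `^ (- (a / 2))) ^+ 2 * t i); last ring.
  rewrite exprMn mulrC; apply: ler_wpM2l; first exact: sqr_ge0.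
  by rewrite lerDl ltW.
apply: (le_trans (ler_sum _ (fun i _ => bnd i))).
rewrite [leLHS](_ : _ = d%:R * s ^+ 2 + (- (2 * s ^+ 2 * k) * (S `^ ((a - 2) / p) * W) +
    k ^+ 2 * (S `^ ((a - 2) / p) * (S `^ ((a - 2) / p) * U)))); last first.
  by rewrite 2!big_split/= sumr_const card_ord -(mulr_natl (s ^+ 2) d) /U /W !mulr_sumr addrA.
rewrite gerDl.
rewrite [leLHS](_ : _ = (S `^ ((a - 2) / p) * s ^+ 2 * k) *
    (c * (S `^ ((a - 2) / p) * U) - 2 * W)); last by rewrite /k; ring.
rewrite pmulr_rle0 ?subr_le0//.
by rewrite !mulr_gt0// exprn_gt0.
Qed.

(** [coordinate_risk] holds for each coordinate with the others fixed, hence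
    under [Q] by [resample_le]; the sum over the coordinates is then bounded
    pointwise. The constant [C], added to keep all integrands nonnegative, is
    the same for all [z] and cancels at the end. *)
Lemma regularized_risk (Q : probability (d.-tuple R) R) theta :
  normal_law Q theta s ->
  (\int[Q]_z (\sum_(i < d)
     (Num.max 0 (1 - k * reg_shrink z i) * tnth z i - tnth theta i) ^+ 2)%:E
    <= (d%:R * s ^+ 2)%:E)%E.
Proof.
move=> hQ.
pose C := 2 * s ^+ 2 * (k * e^-1).
have C0 : 0 <= C by rewrite !mulr_ge0 ?sqr_ge0 ?invr_ge0 ?ltW.
pose L i z := (Num.max 0 (1 - k * reg_shrink z i) * tnth z i - tnth theta i) ^+ 2.
have L0 i z : 0 <= L i z by exact: sqr_ge0.
have mt i : measurable_fun [set: d.-tuple R] (fun z : d.-tuple R => tnth z i) by exact: measurable_tnth.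
have mL i : measurable_fun [set: d.-tuple R] (L i).
  apply: measurable_funX; apply: measurable_funB => //; apply: measurable_funM => //.
  apply: measurable_maxr => //; apply: measurable_funB => //; apply: measurable_funM => //.
  exact: measurable_reg_shrink.
have mr i : measurable_fun [set: d.-tuple R] (fun z => unbiased_risk z i).
  apply: measurable_funD.
    apply: measurable_funD => //; apply: measurable_funM => //; apply: measurable_funM => //.
    exact: measurable_reg_dshrink.
  apply: measurable_funX; apply: measurable_funM => //; apply: measurable_funM => //.
  exact: measurable_reg_shrink.
have r0 z i : 0 <= unbiased_risk z i + C.
  have h := @dshrink1_le R p a e (reg_rest z i) p0 a0 alt1 e0 (rest_ge0 z i) (tnth z i).
  rewrite /unbiased_risk addrAC addr_ge0 ?sqr_ge0// -addrA addr_ge0 ?sqr_ge0//.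
  rewrite /C -mulrDr; apply: mulr_ge0; first by rewrite mulr_ge0 ?sqr_ge0.
  by rewrite mulNr addrC -mulrBr; apply: mulr_ge0; [exact: ltW|rewrite subr_ge0].
have step i : (\int[Q]_z (L i z + C)%:E <= \int[Q]_z (unbiased_risk z i + C)%:E)%E.
  apply: (resample_le Q theta s i _ _ hQ).
  - by apply/measurable_EFinP; apply: measurable_funD.
  - by move=> z; rewrite lee_fin addr_ge0.
  - by apply/measurable_EFinP; apply: measurable_funD.
  - by move=> z; rewrite lee_fin.
  move=> z.
  under eq_integral do rewrite /L /reg_shrink rest_update tnth_update eqxx.
  under [leRHS]eq_integral do
    rewrite /unbiased_risk /reg_dshrink /reg_shrink rest_update tnth_update eqxx.
  exact: coordinate_risk.
have dC : (\int[Q]_z (\sum_(i < d) L i z + d%:R * C)%:E <= (d%:R * s ^+ 2 + d%:R * C)%:E)%E.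
  rewrite (eq_integral (fun z => \sum_(i < d) (L i z + C)%:E)%E); last first.
    move=> z _; rewrite sumEFin; congr EFin.
    by rewrite big_split/= sumr_const card_ord mulr_natl.
  rewrite ge0_integral_sum//; first last.
  - by move=> i z _; rewrite lee_fin addr_ge0.
  - by move=> i; apply/measurable_EFinP; apply: measurable_funD.
  apply: (le_trans (lee_sum _ (fun i _ => step i))).
  rewrite -ge0_integral_sum//; first last.
  - by move=> i z _; rewrite lee_fin.
  - by move=> i; apply/measurable_EFinP; apply: measurable_funD.
  apply: (@le_trans _ _ (\int[Q]_z (cst (d%:R * s ^+ 2 + d%:R * C)%:E z))%E).
    apply: ge0_le_integral => //.
    - by move=> z _; apply: sume_ge0 => i _; rewrite lee_fin.
    - by apply: emeasurable_sum => i; apply/measurable_EFinP; apply: measurable_funD.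
    - move=> z _; rewrite sumEFin lee_fin big_split/= sumr_const card_ord.
      by rewrite [X in _ + X](_ : _ = d%:R * C) ?lerD2r ?sum_unbiased_risk_le// mulr_natl.
  rewrite integral_cst// [X in (_ * X)%E](_ : _ = 1%E) ?mule1//; exact: probability_setT.
have -> : (\int[Q]_z (\sum_(i < d) L i z)%:E = \int[Q]_z (\sum_(i < d) L i z + d%:R * C)%:E - (d%:R * C)%:E)%E.
  under [in RHS]eq_integral do rewrite EFinD.
  rewrite ge0_integralD//.
  - rewrite integral_cst// [X in (_ * X)%E](_ : _ = 1%E) ?mule1; last exact: probability_setT.
    by rewrite addeK.
  - by move=> z _; rewrite lee_fin sumr_ge0.
  - by apply/measurable_EFinP; apply: measurable_sum.
  - by move=> z _; rewrite lee_fin mulr_ge0.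
by rewrite leeBlDr// -EFinD.
Qed.

End regularized.

(** * Passage to the limit *)

Section limit.
Context {R : realType}.

Lemma cvg_sumr (I : Type) (r : seq I) (u : I -> R^nat) (l : I -> R) :
  (forall i, u i n @[n --> \oo] --> l i) ->
  (\sum_(i <- r) u i n) @[n --> \oo] --> \sum_(i <- r) l i.
Proof.
move=> ul; elim: r => [|i r IH].
  by rewrite big_nil; under eq_fun do rewrite big_nil; exact: cvg_cst.
by rewrite big_cons; under eq_fun do rewrite big_cons; apply: cvgD.
Qed.

Lemma cvg_max0 (u : R^nat) (l : R) : u n @[n --> \oo] --> l ->
  Num.max 0 (u n) @[n --> \oo] --> Num.max 0 l.
Proof.
move=> ul; rewrite Num.Theory.maxr_absE.
under eq_fun do rewrite Num.Theory.maxr_absE.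
apply: cvgM; last exact: cvg_cst.
apply: cvgD; first by apply: cvgD => //; exact: cvg_cst.
by apply: cvg_norm; apply: cvgB => //; exact: cvg_cst.
Qed.

Lemma cvg_powR_at (r x : R) (u : R^nat) : 0 < x -> u n @[n --> \oo] --> x ->
  u n `^ r @[n --> \oo] --> x `^ r.
Proof.
move=> x0 ux; apply: (@cvg_comp _ _ _ u (fun y => y `^ r) _ _ _ ux).
exact: (continuous_powR_comp (fun y => y) r x x0 (@cvg_id _ _)).
Qed.

Lemma cvg_sqr_harmonic (x : R) : x ^+ 2 + harmonic n @[n --> \oo] --> x ^+ 2.
Proof.
rewrite -[X in _ --> X]addr0; apply: cvgD; [exact: cvg_cst|exact: cvg_harmonic].
Qed.

Lemma sqr_powR (x r : R) : (x ^+ 2) `^ (r / 2) = `|x| `^ r.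
Proof.
rewrite -[x ^+ 2]real_normK ?num_real// -powR_mulrn// -powRrM.
by congr (_ `^ _); field.
Qed.

(** At [x = 0] this is a one-sided limit, which requires [0 < p]; elsewhere it
    is continuity of the power. *)
Lemma cvg_powR_harmonic (p x : R) : 0 < p ->
  (x ^+ 2 + harmonic n) `^ (p / 2) @[n --> \oo] --> `|x| `^ p.
Proof.
move=> p0; rewrite -sqr_powR; have [->|x0] := eqVneq x 0.
  rewrite expr0n/= powR0 ?gt_eqF ?divr_gt0//.
  under eq_fun do rewrite add0r.
  have h : a `^ (p / 2) @[a --> 0^'+] --> (0 : R) by apply: powR_cvg0; rewrite divr_gt0.
  apply: ((cvg_at_rightP _ 0 0).1 h); split; last exact: cvg_harmonic.
  by move=> n; rewrite /harmonic/= invr_gt0 ltr0n.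
apply: cvg_powR_at; last exact: cvg_sqr_harmonic.
by rewrite exprn_even_gt0.
Qed.

Variables (d : nat) (p a c s : R).
Hypothesis p0 : 0 < p.

(** Where [z_i = 0] both sides vanish; elsewhere the power sum has a positive
    limit, so that its negative powers are continuous. *)
Lemma cvg_regularized (z : d.-tuple R) (i : 'I_d) :
  Num.max 0 (1 - c * s ^+ 2 * reg_shrink d p a (harmonic n) z i) * tnth z i
    @[n --> \oo] --> tnth (theta_plus p a c s z) i.
Proof.
rewrite tnth_mktuple.
have [->|zi0] := eqVneq (tnth z i) 0.
  by rewrite mulr0; under eq_fun do rewrite mulr0; exact: cvg_cst.
have zi : 0 < `|tnth z i| by rewrite normr_gt0.
apply: cvgM; last exact: cvg_cst.
apply: cvg_max0; apply: cvgB; first exact: cvg_cst.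
apply: cvgM; first exact: cvg_cst.
set S := \sum_(j < d) `|tnth z j| `^ p.
have S0 : 0 < S.
  by rewrite /S (bigD1 i)//= ltr_wpDr ?powR_gt0// sumr_ge0// => j _; exact: powR_ge0.
have -> : (lpnorm p z `^ (2 - a) * `|tnth z i| `^ a)^-1 =
    S `^ ((a - 2) / p) * (tnth z i ^+ 2) `^ (- (a / 2)).
  rewrite invfM -!powRN /lpnorm -/S -powRrM -mulNr sqr_powR.
  by congr (_ `^ _ * _); field; rewrite gt_eqF.
rewrite /reg_shrink /shrink1; apply: cvgM.
  apply: cvg_powR_at => //.
  under eq_fun do rewrite reg_sum.
  by apply: cvg_sumr => j; exact: cvg_powR_harmonic.
apply: cvg_powR_at; last exact: cvg_sqr_harmonic.
by rewrite exprn_even_gt0.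
Qed.

Lemma measurable_theta_plus :
  measurable_fun [set: d.-tuple R] (theta_plus p a c s).
Proof.
apply/measurable_fun_tnthP => i.
have mt j : measurable_fun [set: d.-tuple R] (fun z : d.-tuple R => tnth z j) by exact: measurable_tnth.
have mn j r : measurable_fun [set: d.-tuple R] (fun z : d.-tuple R => `|tnth z j| `^ r).
  apply: (measurableT_comp (measurable_powR r)).
  exact: (measurableT_comp (@normr_measurable R setT)).
rewrite (_ : _ \o _ = fun z => Num.max 0 (1 - c * s ^+ 2 *
   (lpnorm p z `^ (- (2 - a)) * `|tnth z i| `^ (- a))) * tnth z i); last first.
  by apply/funext => z; rewrite /= tnth_mktuple invfM -!powRN.
apply: measurable_funM => //; apply: measurable_maxr => //; apply: measurable_funB => //.
apply: measurable_funM => //; apply: measurable_funM => //.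
apply: (measurableT_comp (measurable_powR _)).
apply: (measurableT_comp (measurable_powR _)).
exact: measurable_sum.
Qed.

End limit.

Section upper.
Context {R : realType}.
Variables (d : nat) (p a c s : R).
Hypotheses (d3 : (3 <= d)%N) (p0 : 0 < p) (a0 : 0 <= a).
Hypothesis a1 : a < (d%:R - 2) / (d%:R - 1).
Hypotheses (c0 : 0 < c) (hc : c <= 2 * (d%:R - 2) * gamma_const d p a).
Hypotheses (s0 : 0 < s).

(** Fatou's lemma along [e = 1 / (n + 1)]. *)
Lemma theta_plus_sq_risk (Q : probability (d.-tuple R) R) theta :
  normal_law Q theta s ->
  (\int[Q]_z (\sum_(i < d) (tnth (theta_plus p a c s z) i - tnth theta i) ^+ 2)%:E
    <= (d%:R * s ^+ 2)%:E)%E.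
Proof.
move=> hQ.
pose L n (z : d.-tuple R) := \sum_(i < d)
     (Num.max 0 (1 - c * s ^+ 2 * reg_shrink d p a (harmonic n) z i) * tnth z i - tnth theta i) ^+ 2.
have mL n : measurable_fun [set: d.-tuple R] (fun z => (L n z)%:E).
  apply/measurable_EFinP; apply: measurable_sum => i; apply: measurable_funX.
  apply: measurable_funB => //; apply: measurable_funM; last exact: measurable_tnth.
  apply: measurable_maxr => //; apply: measurable_funB => //; apply: measurable_funM => //.
  exact: measurable_reg_shrink.
have L0 n z : (0 <= (L n z)%:E)%E by rewrite lee_fin sumr_ge0// => i _; exact: sqr_ge0.
have Llim z : (L n z)%:E @[n --> \oo] --> (\sum_(i < d) (tnth (theta_plus p a c s z) i - tnth theta i) ^+ 2)%:E.
  apply: cvg_EFin; first exact: nearW.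
  apply: cvg_sumr => i; rewrite expr2.
  under eq_fun do rewrite expr2.
  have h : Num.max 0 (1 - c * s ^+ 2 * reg_shrink d p a (harmonic n) z i) * tnth z i - tnth theta i
    @[n --> \oo] --> tnth (theta_plus p a c s z) i - tnth theta i.
    by apply: cvgB; [exact: cvg_regularized|exact: cvg_cst].
  by apply: cvgM.
have -> : (\int[Q]_z (\sum_(i < d) (tnth (theta_plus p a c s z) i - tnth theta i) ^+ 2)%:E =
  \int[Q]_z limn_einf (fun n => (L n z)%:E))%E.
  by apply: eq_integral => z _; rewrite (cvg_limn_einf_sup (Llim z)).1.
apply: (le_trans (fatou Q measurableT mL (fun n z _ => L0 n z))).
have hn (n : nat) : (\int[Q]_z (L n z)%:E <= (d%:R * s ^+ 2)%:E)%E.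
  apply: regularized_risk => //.
  by rewrite /harmonic/= invr_gt0 ltr0n.
rewrite limn_einf_lim; apply: lime_le; first exact: is_cvg_einfs.
apply: nearW => n; apply: le_trans (hn n).
by apply: ereal_inf_lbound; exists n => /=.
Qed.

End upper.

(** * Bayes risk in dimension one *)

Section bayes1.
Context {R : realType}.
Local Notation mu := (@lebesgue_measure R).

(** The mean squared deviation from a constant is at least the variance. With
    [g = m - y / k] constant, [y - k x = - k (x - m + g)], and [normal_sure]
    computes the moment. *)
Lemma normal_second_moment_ge (m s k y : R) : s != 0 -> 0 < k ->
  ((k ^+ 2 * s ^+ 2)%:E <= \int[normal_prob m s]_x ((y - k * x) ^+ 2)%:E)%E.
Proof.
move=> s0 k0; have kn0 : k != 0 by rewrite gt_eqF.
pose g := m - y / k.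
have h : (\int[normal_prob m s]_x ((x - m + g) ^+ 2 + 0)%:E =
   \int[normal_prob m s]_x (s ^+ 2 + 2 * s ^+ 2 * 0 + g ^+ 2 + 0)%:E)%E.
  apply: (@normal_sure R m s 0 `|g| (fun=> g) (fun=> 0)) => //.
  - by move=> x; exact: cvg_cst.
  - by move=> x; rewrite mulr0 !addr0 addr_ge0 ?sqr_ge0.
have -> : (\int[normal_prob m s]_x ((y - k * x) ^+ 2)%:E =
    \int[normal_prob m s]_x ((k ^+ 2)%:E * ((x - m + g) ^+ 2 + 0)%:E))%E.
  by apply: eq_integral => x _; rewrite -EFinM; congr EFin; rewrite /g; field.
rewrite ge0_integralZl//=.
- rewrite h integral_cst// [X in (_ * (_ * X))%E](_ : _ = 1%E); last exact: probability_setT.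
  rewrite mule1 -EFinM lee_fin mulr0 !addr0 ler_wpM2l ?sqr_ge0//.
  by rewrite lerDl sqr_ge0.
- apply/measurable_EFinP; apply: measurable_funD => //; apply: measurable_funX.
  by apply: measurable_funD => //; exact: measurable_funB.
- by move=> x _; rewrite lee_fin addr0 sqr_ge0.
- by rewrite lee_fin sqr_ge0.
Qed.

(** If [x] has law N(0, s^2) and [u] given [x] has law N(k x, s^2), then [u] has
    law N(0, s^2 (1 + k^2)), and [x] given [u] has mean [k u / (1 + k^2)] and
    variance [s^2 / (1 + k^2)]. *)
Lemma normal_posterior (s k x u : R) : s != 0 ->
  normal_pdf 0 s x * normal_pdf (k * x) s u =
  normal_pdf 0 (s * Num.sqrt (1 + k ^+ 2)) u *
  normal_pdf (k * u / (1 + k ^+ 2)) (s / Num.sqrt (1 + k ^+ 2)) x.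
Proof.
move=> s0.
have k1 : 0 < 1 + k ^+ 2 by rewrite ltr_pwDl// sqr_ge0.
have r2 : Num.sqrt (1 + k ^+ 2) ^+ 2 = 1 + k ^+ 2 by rewrite sqr_sqrtr// ltW.
have r0 : Num.sqrt (1 + k ^+ 2) != 0 by rewrite sqrtr_eq0 -ltNge.
set r := Num.sqrt _ in r2 r0 *.
rewrite !normal_pdfE ?mulf_neq0 ?invr_eq0//=.
rewrite mulrACA [RHS]mulrACA; congr (_ * _).
  rewrite /normal_peak -!invfM; congr (_^-1).
  have v0 v : 0 <= v ^+ 2 * pi *+ 2 :> R by rewrite mulrn_wge0// mulr_ge0 ?sqr_ge0// pi_ge0.
  rewrite -!sqrtrM//.
  by congr Num.sqrt; rewrite !exprMn exprVn r2; field; rewrite gt_eqF.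
rewrite /normal_fun -!expRD; congr expR.
rewrite !exprMn exprVn r2; field.
by rewrite s0 gt_eqF.
Qed.

(** The integration over [x] is moved inside by Tonelli's theorem; for fixed
    [u] it is then an integral against the posterior law of [x], bounded below
    by the posterior variance of [k x]. *)
Lemma bayes_risk1 (f : R -> R) (s k : R) : s != 0 -> 0 < k ->
  measurable_fun [set: R] f ->
  ((k ^+ 2 * s ^+ 2 / (1 + k ^+ 2))%:E <=
   \int[normal_prob 0 s]_x \int[normal_prob (k * x) s]_u ((f u - k * x) ^+ 2)%:E)%E.
Proof.
move=> s0 k0 mf.
have k1 : 0 < 1 + k ^+ 2 by rewrite ltr_pwDl// sqr_ge0.
have r2 : Num.sqrt (1 + k ^+ 2) ^+ 2 = 1 + k ^+ 2 by rewrite sqr_sqrtr// ltW.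
have r0 : Num.sqrt (1 + k ^+ 2) != 0 by rewrite sqrtr_eq0 -ltNge.
pose T := measurableTypeR R.
pose w (z : T * T) := (f z.2 - k * z.1) ^+ 2.
have mw : measurable_fun setT w.
  apply: measurable_funX; apply: measurable_funB.
    exact: (measurableT_comp mf).
  exact: measurable_funM.
have mp : measurable_fun setT (fun z : T * T => normal_pdf (k * z.1) s z.2).
  rewrite (_ : (fun _ => _) = (fun z : T * T => normal_pdf 0 s (z.2 - k * z.1))); last first.
    by apply/funext => z; rewrite !normal_pdfE//= /normal_fun subr0.
  apply: (measurableT_comp (measurable_normal_pdf 0 s)).
  by apply: measurable_funB => //; exact: measurable_funM.
have mp0 : measurable_fun setT (fun z : T * T => normal_pdf 0 s z.1).
  exact: (measurableT_comp (measurable_normal_pdf 0 s)).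
pose F (z : T * T) := (w z * normal_pdf (k * z.1) s z.2 * normal_pdf 0 s z.1)%:E.
have F0 z : (0 <= F z)%E.
  by rewrite lee_fin mulr_ge0 ?normal_pdf_ge0// mulr_ge0 ?normal_pdf_ge0// sqr_ge0.
have mF : measurable_fun setT F.
  by apply/measurable_EFinP; apply: measurable_funM => //; exact: measurable_funM.
have mfx x : measurable_fun [set: R] (fun u => ((f u - k * x) ^+ 2)%:E).
  by apply/measurable_EFinP; apply: measurable_funX; exact: measurable_funB.
have mfu (u : R) : measurable_fun [set: R] (fun x => ((f u - k * x) ^+ 2)%:E).
  apply/measurable_EFinP; apply: measurable_funX; exact: measurable_funB.
pose F1 (z : T * T) := (w z * normal_pdf (k * z.1) s z.2)%:E.
have F10 z : (0 <= F1 z)%E.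
  by rewrite lee_fin mulr_ge0 ?normal_pdf_ge0// sqr_ge0.
have mF1 : measurable_fun setT F1.
  by apply/measurable_EFinP; exact: measurable_funM.
rewrite (eq_integral (fun x => \int[mu]_u F1 (x, u)))%E; last first.
  move=> x _; rewrite ge0_integral_normal//; last by move=> u; rewrite lee_fin sqr_ge0.
have mI : measurable_fun [set: R] (fun x => \int[mu]_u F1 (x, u))%E.
  exact: (@measurable_fun_fubini_tonelli_F _ _ T T R mu F1 mF1 F10).
rewrite ge0_integral_normal//; last by move=> x; apply: integral_ge0.
have -> : (\int[mu]_x (\int[mu]_u F1 (x, u) * (normal_pdf 0 s x)%:E) =
    \int[mu]_x \int[mu]_u F (x, u))%E.
  apply: eq_integral => x _; rewrite -ge0_integralZr//.
  - exact: (measurableT_comp mF1 (measurable_pair1 (x : T))).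
  - by rewrite lee_fin normal_pdf_ge0.
rewrite (@fubini_tonelli _ _ T T R mu mu F mF F0).
pose S := s * Num.sqrt (1 + k ^+ 2).
have inner (u : R) : ((k ^+ 2 * s ^+ 2 / (1 + k ^+ 2))%:E * (normal_pdf 0 S u)%:E
     <= \int[mu]_x F (x, u))%E.
  have -> : (\int[mu]_x F (x, u) = \int[mu]_x ((normal_pdf 0 S u)%:E * (((f u - k * x) ^+ 2)%:E *
     (normal_pdf (k * u / (1 + k ^+ 2)) (s / Num.sqrt (1 + k ^+ 2)) x)%:E)))%E.
    apply: eq_integral => x _; rewrite /F /w/= -!EFinM; congr EFin.
    by rewrite -mulrA [X in _ * X]mulrC normal_posterior// mulrCA.
  rewrite ge0_integralZl//; first last.
  - by rewrite lee_fin normal_pdf_ge0.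
  - by move=> x _; rewrite -EFinM lee_fin mulr_ge0 ?sqr_ge0 ?normal_pdf_ge0.
  - apply: emeasurable_funM; first exact: mfu.
    by apply/measurable_EFinP; exact: measurable_normal_pdf.
  rewrite -ge0_integral_normal//; last by move=> x; rewrite lee_fin sqr_ge0.
  rewrite muleC lee_wpmul2l ?lee_fin ?normal_pdf_ge0//.
  have := @normal_second_moment_ge (k * u / (1 + k ^+ 2)) (s / Num.sqrt (1 + k ^+ 2)) k (f u).
  rewrite mulf_neq0 ?invr_eq0// => /(_ isT k0).
  by rewrite exprMn exprVn r2 mulrA.
apply: (@le_trans _ _ (\int[mu]_u ((k ^+ 2 * s ^+ 2 / (1 + k ^+ 2))%:E * (normal_pdf 0 S u)%:E))%E).
  rewrite ge0_integralZl//.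
  - by rewrite integral_normal_pdf mule1.
  - by apply/measurable_EFinP; exact: measurable_normal_pdf.
  - by move=> u _; rewrite lee_fin normal_pdf_ge0.
  - by rewrite lee_fin divr_ge0 ?(ltW k1)// mulr_ge0 ?sqr_ge0.
apply: ge0_le_integral; [exact: measurableT| | | |by move=> u _; exact: inner].
- move=> u _; rewrite -EFinM lee_fin mulr_ge0 ?normal_pdf_ge0//.
  by rewrite divr_ge0 ?(ltW k1)// mulr_ge0 ?sqr_ge0.
- apply: emeasurable_funM => //.
  by apply/measurable_EFinP; exact: measurable_normal_pdf.
- exact: (@measurable_fun_fubini_tonelli_G _ _ T T R mu F mF F0).
Qed.

Lemma normal_shift (m s : R) (g : R -> \bar R) : s != 0 ->
  measurable_fun [set: R] g -> (forall x, 0 <= g x)%E ->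
  (\int[normal_prob 0 s]_y g (y + m)%R = \int[normal_prob m s]_u g u)%E.
Proof.
move=> s0 mg g0.
have mD : measurable_fun [set: R] (fun y => y + m) by exact: measurable_funD.
rewrite ge0_integral_normal//; last exact: measurableT_comp.
pose h u := (g u * (normal_pdf m s u)%:E)%E.
rewrite [RHS]ge0_integral_normal; [|exact: mg|exact: g0].
rewrite -[RHS](ge0_integral_shift m h).
- by apply: eq_integral => x _; rewrite /h !normal_pdfE//= /normal_fun subr0 addrK.
- apply: emeasurable_funM => //; apply/measurable_EFinP; exact: measurable_normal_pdf.
- by move=> x; rewrite mule_ge0// lee_fin normal_pdf_ge0.
Qed.

Lemma normal_prob_shift (m s : R) (B : set R) : s != 0 -> measurable B ->
  (normal_prob m s B = normal_prob 0 s ((fun y => (y + m)%R) @^-1` B))%E.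
Proof.
move=> s0 mB.
have mD : measurable_fun [set: R] (fun y => y + m) by exact: measurable_funD.
have mB' : measurable ((fun y => y + m) @^-1` B).
  by rewrite -[X in measurable X]setTI; exact: mD.
transitivity (\int[normal_prob m s]_u (\1_B u)%:E)%E.
  by rewrite integral_indic// setIT.
rewrite -(normal_shift m s (fun u => (\1_B u)%:E))//; last first.
  by apply/measurable_EFinP; exact: measurable_indic.
transitivity (\int[normal_prob 0 s]_y (\1_((fun y => (y + m)%R) @^-1` B) y)%:E)%E => //.
by rewrite integral_indic// setIT.
Qed.

End bayes1.

(** * Lower bound on the maximal risk *)

Section lower.
Context {R : realType} {d : nat}.

Lemma probability_integral_ge {disp} {T : measurableType disp} (Q : probability T R)
    (c : R) (f : T -> \bar R) :
  0 <= c -> measurable_fun setT f -> (forall z, c%:E <= f z)%E ->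
  (c%:E <= \int[Q]_z f z)%E.
Proof.
move=> c0 mf cf.
apply: (@le_trans _ _ (\int[Q]_z (cst c%:E z))%E).
  by rewrite integral_cst// [X in (_ * X)%E](_ : _ = 1%E) ?mule1//; exact: probability_setT.
apply: ge0_le_integral; [exact: measurableT| | | |by move=> z _; exact: cf].
- by move=> z _; rewrite lee_fin.
- exact: measurable_cst.
- exact: mf.
Qed.

Definition translate (theta z : d.-tuple R) : d.-tuple R :=
  [tuple tnth z j + tnth theta j | j < d].
Definition dilate (k : R) (z : d.-tuple R) : d.-tuple R :=
  [tuple k * tnth z j | j < d].

Lemma measurable_translate theta : measurable_fun [set: d.-tuple R] (translate theta).
Proof.
apply/measurable_fun_tnthP => j.
rewrite (_ : _ \o _ = fun z => tnth z j + tnth theta j).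
  by apply: measurable_funD => //; exact: measurable_tnth.
by apply/funext => z; rewrite /= tnth_mktuple.
Qed.

Lemma measurable_observation (k : R) :
  measurable_fun [set: d.-tuple R * d.-tuple R] (fun w => translate (dilate k w.1) w.2).
Proof.
have mt j : measurable_fun [set: d.-tuple R] (fun z : d.-tuple R => tnth z j) by exact: measurable_tnth.
apply/measurable_fun_tnthP => j.
rewrite (_ : _ \o _ = fun w : d.-tuple R * d.-tuple R => tnth w.2 j + k * tnth w.1 j).
  apply: measurable_funD; first exact: (measurableT_comp (mt j)).
  by apply: measurable_funM => //; exact: (measurableT_comp (mt j)).
by apply/funext => w; rewrite /= !tnth_mktuple.
Qed.

Definition origin : d.-tuple R := [tuple 0 | _ < d].

Lemma tnth_origin j : tnth origin j = 0.
Proof. by rewrite tnth_mktuple. Qed.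

(** The laws with different means are translates of each other. Averaging the
    risk over the mean requires measurability in the mean; here it comes from
    that of the translation. *)
Lemma normal_law_translate (Q0 Q : probability (d.-tuple R) R) theta s (f : d.-tuple R -> \bar R) :
  s != 0 -> normal_law Q0 origin s -> normal_law Q theta s ->
  measurable_fun setT f -> (forall z, 0 <= f z)%E ->
  (\int[Q]_z f z = \int[Q0]_z f (translate theta z))%E.
Proof.
move=> s0 h0 h mf f0.
pose phi : {mfun d.-tuple R >-> d.-tuple R} :=
  @mfun_Sub _ _ (d.-tuple R) (d.-tuple R) _ (mem_set (measurable_translate theta)).
transitivity (\int[pushforward Q0 phi]_z f z)%E.
  apply: eq_measure_integral => A mA _.
  apply: (@box_measure_unique R d Q (pushforward Q0 phi)) => //.
    by apply: (@le_lt_trans _ _ 1%E); [exact: probability_le1|exact: ltry].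
  move=> B mB.
  transitivity (\prod_(j < d) normal_prob (tnth theta j) s (B j))%E; first exact: h.
  have mB' j : measurable ((fun y : R => y + tnth theta j) @^-1` B j).
    rewrite -[X in measurable X]setTI.
    have mD : measurable_fun [set: R] (fun y : R => y + tnth theta j) by exact: measurable_funD.
    exact: mD.
  have phiB : phi @^-1` box B = box (fun j => (fun y : R => y + tnth theta j) @^-1` B j).
    by apply/seteqP; split => z zB j; have := zB j; rewrite /= tnth_mktuple.
  transitivity (Q0 (box (fun j => (fun y : R => y + tnth theta j) @^-1` B j))).
    transitivity (\prod_(j < d) normal_prob (tnth origin j) s
        ((fun y : R => y + tnth theta j)%R @^-1` B j))%E; last by apply/esym/h0.
    apply: eq_bigr => j _; rewrite tnth_origin.
    exact: (normal_prob_shift (tnth theta j) s (B j) s0 (mB j)).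
  by rewrite -phiB.
rewrite ge0_integral_pushforward// preimage_setT//.
Qed.

(** Resampling the coordinate [i] of [a] and of [b] to [x] and [y] turns the
    integrand into [(f (y + k x) - k x)^2], where [f] depends on the remaining
    coordinates, and the bound [bayes_risk1] does not depend on [f]. *)
Lemma bayes_risk_coordinate (Q0 : probability (d.-tuple R) R) (s k : R) (i : 'I_d)
    (g : d.-tuple R -> R) :
  s != 0 -> 0 < k -> normal_law Q0 origin s -> measurable_fun setT g ->
  ((k ^+ 2 * s ^+ 2 / (1 + k ^+ 2))%:E <=
   \int[Q0]_a \int[Q0]_b ((g (translate (dilate k a) b) - k * tnth a i) ^+ 2)%:E)%E.
Proof.
move=> s0 k0 h0 mg.
set c := k ^+ 2 * s ^+ 2 / (1 + k ^+ 2).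
have c0 : 0 <= c by rewrite /c -exprMn divr_ge0 ?sqr_ge0// addr_ge0// sqr_ge0.
pose V := (d.-tuple R).
pose T := measurableTypeR R.
pose F (w : V * V) := ((g (translate (dilate k w.1) w.2) - k * tnth w.1 i) ^+ 2)%:E.
have F0 w : (0 <= F w)%E by rewrite lee_fin sqr_ge0.
have mF : measurable_fun setT F.
  apply/measurable_EFinP; apply: measurable_funX; apply: measurable_funB.
    exact: (measurableT_comp mg (measurable_observation k)).
  apply: measurable_funM => //.
  exact: (measurableT_comp (measurable_tnth i)).
have mPhi : measurable_fun setT (fun a : V => \int[Q0]_b F (a, b))%E.
  exact: (@measurable_fun_fubini_tonelli_F _ _ V V R Q0 F mF F0).
rewrite (resample Q0 origin s i (fun a : V => \int[Q0]_b F (a, b))%E)//; last first.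
  by move=> a; apply: integral_ge0.
rewrite tnth_origin.
have mN : measurable_fun setT (fun a : V => \int[normal_prob 0 s]_x \int[Q0]_b F (update a i x, b))%E.
  apply: (@measurable_fun_fubini_tonelli_F _ _ V T R (normal_prob 0 s)
    (fun w => \int[Q0]_b F (update w.1 i w.2, b))%E).
    exact: (measurableT_comp mPhi (measurable_update i)).
  by move=> w; apply: integral_ge0.
apply: probability_integral_ge => // a.
pose Psi (w : T * V) := (\int[normal_prob 0 s]_y F (update a i w.1, update w.2 i y))%E.
have mPsi : measurable_fun setT Psi.
  apply: (@measurable_fun_fubini_tonelli_F _ _ (T * V)%type T R (normal_prob 0 s)
    (fun w => F (update a i w.1.1, update w.1.2 i w.2))) => //.
  apply: (measurableT_comp mF); apply: measurable_fun_pair => /=.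
    apply: (measurableT_comp (measurable_updater a i)).
    exact: (measurableT_comp measurable_fst measurable_fst).
  apply: (measurableT_comp (measurable_update i) (_ : measurable_fun setT
    (fun w : T * V * T => (w.1.2, w.2)))).
  apply: measurable_fun_pair => //=.
  exact: (measurableT_comp measurable_snd measurable_fst).
have Psi0 w : (0 <= Psi w)%E by apply: integral_ge0.
have -> : (\int[normal_prob 0 s]_x \int[Q0]_b F (update a i x, b) =
    \int[normal_prob 0 s]_x \int[Q0]_b Psi (x, b))%E.
  apply: eq_integral => x _.
  have mFx : measurable_fun setT (fun b : V => F (update a i x, b)).
    exact: (measurableT_comp mF (measurable_pair1 (update a i x))).
  rewrite (resample Q0 origin s i _ h0 mFx (fun z => F0 _)) tnth_origin.
  by [].
rewrite (@fubini_tonelli _ _ T V R (normal_prob 0 s) Q0 Psi mPsi Psi0).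
apply: probability_integral_ge => //.
  exact: (@measurable_fun_fubini_tonelli_G _ _ T V R (normal_prob 0 s) Psi mPsi Psi0).
move=> b.
pose v := translate (dilate k a) b.
pose f (u : R) := g (update v i u).
have mf : measurable_fun [set: R] f.
  exact: (measurableT_comp mg (measurable_updater v i)).
apply: (le_trans (bayes_risk1 f s k s0 k0 mf)).
rewrite le_eqVlt; apply/orP; left; apply/eqP; apply: eq_integral => x _.
rewrite -(normal_shift (k * x) s (fun u => ((f u - k * x) ^+ 2)%:E))//.
- apply: eq_integral => y _; rewrite /F /f/=; congr (((g _ - _) ^+ 2)%:E).
    apply: eq_from_tnth => j; rewrite !(tnth_update, tnth_mktuple).
    by case: eqP.
  by rewrite tnth_update eqxx.
- by apply/measurable_EFinP; apply: measurable_funX; exact: measurable_funB.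
- by move=> x0; rewrite lee_fin sqr_ge0.
Qed.

Definition sq_error (a theta : d.-tuple R) : R :=
  \sum_(i < d) (tnth a i - tnth theta i) ^+ 2.

Lemma measurable_sq_error (delta : d.-tuple R -> d.-tuple R) theta :
  measurable_fun setT delta ->
  measurable_fun [set: d.-tuple R] (fun z => (sq_error (delta z) theta)%:E).
Proof.
move=> md; apply/measurable_EFinP; apply: measurable_sum => i.
apply: measurable_funX; apply: measurable_funB => //.
exact: (measurableT_comp (measurable_tnth i) md).
Qed.

Lemma sq_error_ge0 (a theta : d.-tuple R) : 0 <= sq_error a theta.
Proof. by apply: sumr_ge0 => i _; exact: sqr_ge0. Qed.

Context {disp : measure_display} {T : measurableType disp}.
Variables (P : d.-tuple R -> probability T R) (Z : {mfun T >-> d.-tuple R}) (s : R).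

Lemma riskE (delta : d.-tuple R -> d.-tuple R) theta : estimator delta ->
  risk P Z s delta theta =
  ((s ^- 2)%:E * \int[distribution (P theta) Z]_z (sq_error (delta z) theta)%:E)%E.
Proof.
move=> md; rewrite /risk unlock.
rewrite -ge0_integralZl//; first last.
- by rewrite lee_fin invr_ge0 sqr_ge0.
- by move=> z _; rewrite lee_fin sq_error_ge0.
- exact: measurable_sq_error.
rewrite ge0_integral_distribution//.
- apply: eq_integral => w _; rewrite /= -EFinM; congr EFin.
  by rewrite /loss /sq_error mulr_sumr; apply: eq_bigr => i _; rewrite mulrC.
- by apply: emeasurable_funM => //; exact: measurable_sq_error.
- by move=> z; rewrite -EFinM lee_fin mulr_ge0 ?sq_error_ge0// invr_ge0 sqr_ge0.
Qed.

Hypothesis s0 : 0 < s.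
Hypothesis hZ : forall theta, normal_vector (P theta) Z theta s.

Lemma normal_law_distribution theta : normal_law (distribution (P theta) Z) theta s.
Proof. by move=> B mB; exact: hZ. Qed.

(** The risk at the mean [k a], averaged over [a] under the law at mean 0. *)
Lemma max_risk_ge_bayes (k : R) (delta : d.-tuple R -> d.-tuple R) (M : R) :
  0 < k -> estimator delta -> (forall theta, risk P Z s delta theta <= M%:E)%E ->
  d%:R * (k ^+ 2 / (1 + k ^+ 2)) <= M.
Proof.
move=> k0 md rM.
have sn0 : s != 0 by rewrite gt_eqF.
have s2 : 0 < s ^+ 2 by rewrite exprn_gt0.
pose Q0 : probability (d.-tuple R) R := distribution (P origin) Z.
have h0 : normal_law Q0 origin s by exact: normal_law_distribution.
have M0 : 0 <= M.
  rewrite -lee_fin; apply: le_trans (rM origin).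
  rewrite riskE// mule_ge0 ?lee_fin ?invr_ge0 ?sqr_ge0//.
  by apply: integral_ge0 => z _; rewrite lee_fin sq_error_ge0.
pose V := (d.-tuple R).
pose F i (w : V * V) := ((tnth (delta (translate (dilate k w.1) w.2)) i - k * tnth w.1 i) ^+ 2)%:E.
have F0 i w : (0 <= F i w)%E by rewrite lee_fin sqr_ge0.
have mg i : measurable_fun setT (fun z : V => tnth (delta z) i).
  exact: (measurableT_comp (measurable_tnth i) md).
have mF i : measurable_fun setT (F i).
  apply/measurable_EFinP; apply: measurable_funX; apply: measurable_funB.
    exact: (measurableT_comp (mg i) (measurable_observation k)).
  apply: measurable_funM => //.
  exact: (measurableT_comp (measurable_tnth i)).
have mPhi i : measurable_fun setT (fun a : V => \int[Q0]_b F i (a, b))%E.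
  exact: (@measurable_fun_fubini_tonelli_F _ _ V V R Q0 (F i) (mF i) (F0 i)).
have inner (a : V) : (\sum_(i < d) \int[Q0]_b F i (a, b) <= (s ^+ 2 * M)%:E)%E.
  rewrite -ge0_integral_sum//; last first.
    by move=> i; exact: (measurableT_comp (mF i) (measurable_pair1 a)).
  have h1 := rM (dilate k a); rewrite riskE// in h1.
  have h2 := normal_law_distribution (dilate k a).
  have mse := measurable_sq_error delta (dilate k a) md.
  have se0 z : (0 <= (sq_error (delta z) (dilate k a))%:E)%E by rewrite lee_fin sq_error_ge0.
  rewrite (normal_law_translate Q0 _ (dilate k a) s _ sn0 h0 h2 mse se0) in h1.
  have : ((s ^+ 2)%:E * ((s ^- 2)%:E * \int[Q0]_z (sq_error (delta (translate (dilate k a) z)) (dilate k a))%:E)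
     <= (s ^+ 2)%:E * M%:E)%E.
    by rewrite lee_wpmul2l// lee_fin ltW.
  rewrite muleA -EFinM mulfV ?gt_eqF// mul1e -EFinM.
  congr (_ <= _)%E; apply: eq_integral => z _.
  rewrite sumEFin; congr EFin; apply: eq_bigr => i _.
  by rewrite tnth_mktuple.
have outer : (\sum_(i < d) \int[Q0]_a \int[Q0]_b F i (a, b) <= (s ^+ 2 * M)%:E)%E.
  rewrite -ge0_integral_sum//; last by move=> i a _; apply: integral_ge0.
  apply: (@le_trans _ _ (\int[Q0]_a (cst (s ^+ 2 * M)%:E a))%E).
    apply: ge0_le_integral; [exact: measurableT| | | |by move=> a _; exact: inner].
    - by move=> a _; apply: sume_ge0 => i _; apply: integral_ge0.
    - exact: emeasurable_sum.
    - exact: measurable_cst.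
  by rewrite integral_cst// [X in (_ * X)%E](_ : _ = 1%E) ?mule1//; exact: probability_setT.
have : (\sum_(i < d) (k ^+ 2 * s ^+ 2 / (1 + k ^+ 2))%:E <= (s ^+ 2 * M)%:E)%E.
  apply: le_trans outer; apply: lee_sum => i _.
  exact: (bayes_risk_coordinate Q0 s k i (fun z => tnth (delta z) i)).
rewrite sumEFin lee_fin sumr_const card_ord.
rewrite (_ : k ^+ 2 * s ^+ 2 / (1 + k ^+ 2) *+ d = s ^+ 2 * (d%:R * (k ^+ 2 / (1 + k ^+ 2)))); last first.
  by rewrite -[LHS]mulr_natl; ring.
by rewrite ler_pM2l.
Qed.

Lemma max_risk_ge (delta : d.-tuple R -> d.-tuple R) :
  estimator delta -> (d%:R%:E <= max_risk P Z s delta)%E.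
Proof.
move=> md.
have hr theta : (risk P Z s delta theta <= max_risk P Z s delta)%E.
  by apply: ereal_sup_ubound; exists theta.
case E : (max_risk P Z s delta) hr => [M| |] hr; [|by rewrite leey|].
- rewrite lee_fin leNgt; apply/negP => Md.
  have dM : 0 < d%:R - M by rewrite subr_gt0.
  (* Large enough that k^2 (d - M) > M, which contradicts the Bayes bound. *)
  pose k := 1 + `|M| / (d%:R - M).
  have k1 : 1 <= k by rewrite lerDl divr_ge0// ltW.
  have k0 : 0 < k by rewrite (lt_le_trans ltr01).
  have := max_risk_ge_bayes k delta M k0 md hr.
  rewrite mulrA ler_pdivrMr; last by rewrite ltr_pwDl// sqr_ge0.
  have h2 : k * (d%:R - M) = d%:R - M + `|M|.
    by rewrite /k mulrDl mul1r divfK// gt_eqF.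
  have h3 : k * (d%:R - M) <= k ^+ 2 * (d%:R - M).
    by rewrite ler_pM2r// expr2 ler_peMr// ltW.
  have h4 := ler_norm M.
  apply/negP; rewrite -ltNge; lra.
- have := hr origin; rewrite leeNy_eq riskE// => /eqP h.
  have : (0 <= -oo :> \bar R)%E.
    rewrite -h mule_ge0 ?lee_fin ?invr_ge0 ?sqr_ge0//.
    by apply: integral_ge0 => z _; rewrite lee_fin sq_error_ge0.
  by [].
Qed.

End lower.

(** * Minimaxity *)

Theorem mainTheorem1 (R : realType) (d : nat) (hd : (3 <= d)%N)
  (sigma : R) (hsigma : 0 < sigma)
  (disp : measure_display) (T : measurableType disp)
  (P : d.-tuple R -> probability T R) (Z : {mfun T >-> d.-tuple R})
  (hZ : forall theta : d.-tuple R, normal_vector (P theta) Z theta sigma)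
  (p : R) (hp : 0 < p)
  (alpha : R) (halpha0 : 0 <= alpha)
  (halpha1 : alpha < (d%:R - 2) / (d%:R - 1))
  (c : R) (hc0 : 0 < c)
  (hc1 : c <= 2 * (d%:R - 2) * gamma_const d p alpha) :
  minimax P Z sigma (theta_plus p alpha c sigma).
Proof.
have mtp : estimator (@theta_plus R d p alpha c sigma) by exact: measurable_theta_plus.
split=> // delta' md'.
apply: le_trans (max_risk_ge P Z sigma hsigma hZ delta' md').
apply: ge_ereal_sup => _ [theta _ <-].
rewrite riskE//.
have h := theta_plus_sq_risk d p alpha c sigma hd hp halpha0 halpha1 hc0 hc1 hsigma
  (distribution (P theta) Z) theta (normal_law_distribution P Z sigma hZ theta).
apply: (@le_trans _ _ ((sigma ^- 2)%:E * (d%:R * sigma ^+ 2)%:E)%E).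
  by rewrite lee_wpmul2l// lee_fin invr_ge0 sqr_ge0.
by rewrite -EFinM lee_fin mulrCA mulVf ?mulr1// expf_neq0// gt_eqF.
Qed.
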